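(* Let $Z_1=S_2/S_1$. (i) Under the squared error loss $L_1$, the estimator of $\sigma_1^2$ $$\delta_{11}^Q=\begin{cases}\dfrac{(1+Z_1)E(\tau^{-1})}{(m_1+m_2+2)E(\tau^{-2})}\,S_1,&\text{if }0\le Z_1\le \dfrac{m_2}{m_1+2},\\[1em] \dfrac{E(\tau^{-1})}{(m_1+2)E(\tau^{-2})}\,S_1,&\text{otherwise,}\end{cases}$$ dominates $\delta_{01}^Q=\dfrac{E(\tau^{-1})}{(m_1+2)E(\tau^{-2})}S_1$. (ii) Under the entropy loss $L_2$, the estimator of $\sigma_1^2$ $$\delta_{11}^E=\begin{cases}\dfrac{(1+Z_1)}{(m_1+m_2)E(\tau^{-1})}\,S_1,&\text{if }0\le Z_1\le \dfrac{m_2}{m_1},\\[1em] \dfrac{S_1}{m_1E(\tau^{-1})},&\text{otherwise,}\end{cases}$$ has uniformly smaller risk than $\delta_{01}^E=\dfrac{S_1}{m_1E(\tau^{-1})}$.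
   Context: Model: $p,q,m_1,m_2$ are positive integers; $\tau$ is a positive random variable (mixing variable) with known distribution $\Pi$ on $(0,\infty)$, such that the moments $E(\tau^{-1})$ and (for the squared error loss) $E(\tau^{-2})$ are finite. Conditionally on $\tau$, the variables $\boldsymbol X_1,S_1,\boldsymbol X_2,S_2$ are independent with $\boldsymbol X_1\sim N_p(\boldsymbol\theta_1,\frac{\sigma_1^2}{\tau}I)$, $S_1\sim\frac{\sigma_1^2}{\tau}\chi^2_{m_1}$, $\boldsymbol X_2\sim N_q(\boldsymbol\theta_2,\frac{\sigma_2^2}{\tau}I)$, $S_2\sim\frac{\sigma_2^2}{\tau}\chi^2_{m_2}$ (the same $\tau$ for all four). The unknown parameters are $\boldsymbol\theta_1\in\mathbb R^p$, $\boldsymbol\theta_2\in\mathbb R^q$, $\sigma_1,\sigma_2>0$ with the order restriction $\sigma_1\le\sigma_2$. Losses for estimating $\sigma^2$ by $\delta$: squared error loss $L_1(\delta,\sigma^2)=(\delta/\sigma^2-1)^2$ and entropy loss $L_2(\delta,\sigma^2)=\delta/\sigma^2-\ln(\delta/\sigma^2)-1$. The risk $R(\delta)$ of an estimator $\delta$ of $\sigma_1^2$ is the expected loss, a function of the parameters. $\delta_{01}^Q$ and $\delta_{01}^E$ (the best affine equivariant estimators, BAEE, of $\sigma_1^2$ under $L_1$ and $L_2$) are understood to have finite risk. An estimator $\delta'$ dominates $\delta$ if $R(\delta')\le R(\delta)$ for all admissible parameter values, with strict inequality for at least one; $\delta'$ has uniformly smaller risk than $\delta$ if $R(\delta')<R(\delta)$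 for all admissible parameter values. *)

(* Defs.v *)
From HB Require Import structures.
From mathcomp Require Import all_boot all_order all_algebra.
From mathcomp Require Import all_classical all_reals all_analysis.

Set Implicit Arguments.
Unset Strict Implicit.
Unset Printing Implicit Defensive.

Import Order.TTheory GRing.Theory Num.Theory.
Import numFieldNormedType.Exports.

Local Open Scope classical_set_scope.
Local Open Scope ring_scope.

Section laws.
Context {R : realType}.
Local Notation mu := (@lebesgue_measure R).

Definition Gamma (a : R) : R :=
  \int[mu]_(x in `]0, +oo[) (x `^ (a - 1) * expR (- x)).

Definition chi2_pdf (m : nat) (x : R) : R :=
  if 0 < x then
    x `^ (m%:R / 2 - 1) * expR (- (x / 2))
      / (2 `^ (m%:R / 2) * Gamma (m%:R / 2))
  else 0.

Definition chi2_prob (m : nat) (A : set R) : \bar R :=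
  (\int[mu]_(x in A) (chi2_pdf m x)%:E)%E.

(* The law of c * V for V chi-squared with m degrees of freedom. *)
Definition scaled_chi2_prob (c : R) (m : nat) (A : set R) : \bar R :=
  chi2_prob m ((fun v : R => c * v) @^-1` A).

Definition box {n : nat} (B : 'I_n -> set R) : set (n.-tuple R) :=
  [set x | forall i, B i (tnth x i)].

(* The mass that N_n(theta, v I) gives to [box B]. The argument v is a variance,
   while [normal_prob] takes a standard deviation. *)
Definition normal_box {n : nat} (theta : n.-tuple R) (v : R)
    (B : 'I_n -> set R) : \bar R :=
  (\prod_(i < n) normal_prob (tnth theta i) (Num.sqrt v) (B i))%E.

(* E(tau^(-k)) for tau distributed according to Pi. *)
Definition inv_moment (Pi : probability R R) (k : nat) : R :=
  \int[Pi]_t (t ^- k).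

End laws.

Record param (R : realType) (p q : nat) := Param {
  theta1 : p.-tuple R;
  theta2 : q.-tuple R;
  sigma1 : R;
  sigma2 : R }.

Definition admissible (R : realType) (p q : nat) : set (param R p q) :=
  [set th | 0 < sigma1 th /\ 0 < sigma2 th /\ sigma1 th <= sigma2 th].

(* [joint_law] says that, conditionally on tau = t, the variables X1, S1, X2, S2
   are independent with the prescribed laws: the conditional law given tau = t
   is the product one, stated on the measurable rectangles, which form a
   pi-system generating the product sigma-algebra. *)
Record scale_mixture_model (R : realType) (p q m1 m2 : nat)
    (Pi : probability R R) (d : measure_display) (T : measurableType d)
    (P : probability T R) (tau : {mfun T >-> R})
    (X1 : {mfun T >-> p.-tuple R}) (S1 : {mfun T >-> R})
    (X2 : {mfun T >-> q.-tuple R}) (S2 : {mfun T >-> R})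
    (th : param R p q) : Prop := ScaleMixtureModel {
  tau_law : forall A : set R, measurable A -> P (tau @^-1` A) = Pi A;
  joint_law : forall (A : set R) (B1 : 'I_p -> set R) (C1 : set R)
      (B2 : 'I_q -> set R) (C2 : set R),
    measurable A -> (forall i, measurable (B1 i)) -> measurable C1 ->
    (forall j, measurable (B2 j)) -> measurable C2 ->
    P (tau @^-1` A `&` X1 @^-1` box B1 `&` S1 @^-1` C1
         `&` X2 @^-1` box B2 `&` S2 @^-1` C2) =
    (\int[Pi]_(t in A `&` `]0%R, +oo[)
       (normal_box (theta1 th) (sigma1 th ^+ 2 / t)%R B1
        * scaled_chi2_prob (sigma1 th ^+ 2 / t)%R m1 C1
        * normal_box (theta2 th) (sigma2 th ^+ 2 / t)%R B2
        * scaled_chi2_prob (sigma2 th ^+ 2 / t)%R m2 C2))%E }.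

Section decision.
Context {R : realType}.

Definition sq_loss (delta sigmasq : R) : R := (delta / sigmasq - 1) ^+ 2.

Definition entropy_loss (delta sigmasq : R) : R :=
  delta / sigmasq - ln (delta / sigmasq) - 1.

Context {d : measure_display} {T : measurableType d} {p q : nat}.
Implicit Types (P : param R p q -> probability T R) (L : R -> R -> R)
  (delta : T -> R).

(* Risk, as an extended real, of an estimator of sigma1^2. *)
Definition risk P L delta (th : param R p q) : \bar R :=
  ('E_(P th)[fun w => L (delta w) (sigma1 th ^+ 2)%R])%E.

Definition finite_risk P L delta : Prop :=
  forall th, admissible th -> (risk P L delta th < +oo)%E.

Definition dominates P L delta' delta : Prop :=
  (forall th, admissible th -> (risk P L delta' th <= risk P L delta th)%E) /\
  (exists th, admissible th /\ (risk P L delta' th < risk P L delta th)%E).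

Definition uniformly_smaller_risk P L delta' delta : Prop :=
  forall th, admissible th -> (risk P L delta' th < risk P L delta th)%E.

End decision.

Section estimators.
Context {R : realType}.
Variables (Pi : probability R R) (m1 m2 : nat).

Definition delta01Q (s1 : R) : R :=
  inv_moment Pi 1 / ((m1 + 2)%:R * inv_moment Pi 2) * s1.

Definition delta11Q (s1 s2 : R) : R :=
  let z1 := s2 / s1 in
  if 0 <= z1 <= m2%:R / (m1 + 2)%:R then
    (1 + z1) * inv_moment Pi 1 / ((m1 + m2 + 2)%:R * inv_moment Pi 2) * s1
  else inv_moment Pi 1 / ((m1 + 2)%:R * inv_moment Pi 2) * s1.

Definition delta01E (s1 : R) : R := s1 / (m1%:R * inv_moment Pi 1).

Definition delta11E (s1 s2 : R) : R :=
  let z1 := s2 / s1 in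
  if 0 <= z1 <= m2%:R / m1%:R then
    (1 + z1) / ((m1 + m2)%:R * inv_moment Pi 1) * s1
  else s1 / (m1%:R * inv_moment Pi 1).

End estimators.

(* Main.v *)
Require Import Defs.
From HB Require Import structures.
From mathcomp Require Import all_boot all_order all_algebra.
From mathcomp Require Import all_classical all_reals all_analysis.
From mathcomp Require Import measurable_realfun ring lra.
Import Order.TTheory GRing.Theory Num.Theory.
Import numFieldNormedType.Exports.
Local Open Scope classical_set_scope.
Local Open Scope ring_scope.

(** Write [phi0 S1] for the best equivariant estimator and [phi(Z) S1], with
    [Z = S2 / S1] and [phi <= phi0], for its competitor. On the almost sure event
    [S1, S2 > 0] the two losses [L0], [L1] satisfy [L1 + A = L0 + B], where
    [A = a(Z) (S1 / sigma1^2)^(k+1)] and [B = b(Z) (S1 / sigma1^2)^k] are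
    nonnegative: [k = 1], [a = phi0^2 - phi^2], [b = 2 (phi0 - phi)] for the squared
    error, and [k = 0], [a = phi0 - phi], [b = ln (phi0 / phi)] for the entropy
    loss. So it suffices that [E B < E A]. Conditioning on [tau] factors out
    [E(tau^-k)] and reduces both sides to integrals against two independent
    chi-squared densities in [v1, v2], with [Z = rho v2 / v1] and
    [rho = (sigma2 / sigma1)^2 >= 1]. The Euler-type identity
    [E (g (v1 + v2)) = (m1 + m2 + 2k) E g], for [g] positively homogeneous of degree
    [k], then leaves the pointwise inequality
    [E(tau^-k) b(z) (1 + z) <= (m1 + m2 + 2k) E(tau^-(k+1)) a(z)], in which the
    monotonicity of [1 + z] absorbs [rho]. It holds by
    [2 phi <= phi0 + phi], respectively [ln x <= x - 1]. *)

(** * Measures given by a density *)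

Section mdensity.
Context {d} {T : measurableType d} {R : realType}.
Variables (mu : {measure set T -> \bar R}) (w : {mfun T >-> R}).
Local Open Scope ereal_scope.

(** The absolute value keeps the density nonnegative whatever the sign of [w], so the measure
    structure rests on the measurability of [w] alone. *)
Definition mdensity (A : set T) : \bar R := \int[mu]_(x in A) (`|w x| : R)%:E.

Let mw : measurable_fun setT (fun x => (`|w x| : R)%:E).
Proof. by apply/measurable_EFinP; exact: measurableT_comp. Qed.

Let mdensity0 : mdensity set0 = 0.
Proof. by rewrite /mdensity integral_set0. Qed.

Let mdensity_ge0 A : 0 <= mdensity A.
Proof. by apply: integral_ge0 => x _; rewrite lee_fin. Qed.

Let mdensity_sigma_additive : semi_sigma_additive mdensity.
Proof.
move=> F mF tF mUF; rewrite /mdensity; apply: cvg_toP.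
  apply: ereal_nondecreasing_is_cvgn => m n mn.
  apply: lee_sum_nneg_natr => // k _ _; exact: mdensity_ge0.
by rewrite ge0_integral_bigcup//=; exact: measurable_funTS.
Qed.

HB.instance Definition _ := isMeasure.Build _ _ _
  mdensity mdensity0 mdensity_ge0 mdensity_sigma_additive.

Import HBNNSimple.

(** Monotone convergence along simple approximations reduces both sides to simple functions, where
    linearity reduces them to level sets. *)
Lemma ge0_integral_mdensity (f : T -> \bar R) :
  measurable_fun setT f -> (forall x, 0 <= f x) ->
  \int[mdensity]_x f x = \int[mu]_x (f x * (`|w x| : R)%:E).
Proof.
move=> mf f0; pose f_ := nnsfun_approx measurableT mf.
have f_cvg x : (f_ n x)%:E @[n --> \oo] --> f x.
  by apply: cvg_nnsfun_approx => // *; exact: f0.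
transitivity (limn (fun n => \int[mdensity]_x (f_ n x)%:E)).
  rewrite -monotone_convergence//=.
  - by apply: eq_integral => x _; apply/esym/cvg_lim.
  - by move=> n; exact/measurable_EFinP.
  - by move=> n x _; rewrite lee_fin.
  - by move=> x _ m n mn; rewrite lee_fin; exact/lefP/nd_nnsfun_approx.
transitivity (limn (fun n => \int[mu]_x ((f_ n x)%:E * (`|w x| : R)%:E))); last first.
  rewrite -monotone_convergence//=.
  - apply: eq_integral => x _; apply/cvg_lim => //.
    by apply: cvgeZr.
  - by move=> n; apply: emeasurable_funM => //; exact/measurable_EFinP.
  - by move=> n x _; rewrite mule_ge0// lee_fin.
  - move=> x _ m n mn; apply: lee_wpmul2r => //.
    by rewrite lee_fin; exact/lefP/nd_nnsfun_approx.
congr (limn _); apply/funext => n.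
transitivity (\sum_(k \in range (f_ n)) k%:E * mdensity (f_ n @^-1` [set k])).
  under eq_integral do rewrite fimfunE -fsumEFin//.
  rewrite ge0_integral_fsum//; last 2 first.
  - by move=> y; exact/measurable_EFinP/measurable_funM.
  - by move=> y x _; rewrite nnfun_muleindic_ge0.
  apply: eq_fsbigr => r _; rewrite integralZl_indic_nnsfun// integral_indic//=.
  by rewrite setIT.
transitivity (\int[mu]_x \sum_(k \in range (f_ n))
    ((k * \1_(f_ n @^-1` [set k]) x)%:E * (`|w x| : R)%:E)).
  rewrite ge0_integral_fsum//; last 2 first.
  - move=> y; apply: emeasurable_funM => //.
    exact/measurable_EFinP/measurable_funM.
  - by move=> y x _; rewrite mule_ge0// nnfun_muleindic_ge0.
  apply: eq_fsbigr => r rf.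
  have r0 : (0 <= r)%R by move: rf; rewrite inE => -[x _ <-].
  under eq_integral do rewrite EFinM -muleA.
  rewrite ge0_integralZl_EFin//; last first.
    by apply: emeasurable_funM => //; exact/measurable_EFinP.
  congr (_ * _); rewrite /mdensity integral_mkcond; apply: eq_integral => x _.
  by rewrite patchE indicE; case: (x \in _); rewrite ?mul1e ?mul0e.
apply: eq_integral => x _.
rewrite -ge0_mule_fsuml; last by move=> r; exact: nnfun_muleindic_ge0.
by rewrite fsumEFin// -fimfunE.
Qed.

End mdensity.

(** * Lebesgue measure and integral under dilations *)

Section scaling.
Context {R : realType}.
Local Notation mu := (@lebesgue_measure R).
Local Open Scope ereal_scope.

Let mulc_measurable (c : R) :
  measurable_fun setT (fun x : measurableTypeR R => (c * x)%R : measurableTypeR R).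
Proof. exact: mulrl_measurable. Qed.

(** By uniqueness of Lebesgue measure, it is enough that [c] times the image measure under dilation
    by [c] gives each interval its length. *)
Lemma lebesgue_measure_scale (c : R) (A : set R) : (0 < c)%R -> measurable A ->
  mu A = c%:E * mu ((fun x => (c * x)%R) @^-1` A).
Proof.
move=> c0 mA.
pose nu : {measure set (measurableTypeR R) -> \bar R} :=
  mscale (NngNum (ltW c0)) (pushforward mu
    (fun x : measurableTypeR R => (c * x)%R : measurableTypeR R)).
rewrite (@lebesgue_measure_unique _ (nu (mulc_measurable c)))// => _ [[a b]] _ <-.
rewrite /nu /= /mscale/= /pushforward.
have -> : (fun x : R => (c * x)%R) @^-1` `]a, b] = `](a / c)%R, (b / c)%R]%classic.
  apply/seteqP; split => x /=; rewrite !in_itv/= ltr_pdivrMr// ler_pdivlMr//;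
    by rewrite (mulrC c).
rewrite !lebesgue_measure_itv/= !lte_fin.
rewrite ltr_pM2r ?invr_gt0//; case: ifPn => _; last by rewrite mule0.
by rewrite -!EFinD -EFinM -mulrBl mulrC divfK ?gt_eqF.
Qed.

Lemma ge0_integral_scale (c : R) (f : R -> \bar R) : (0 < c)%R ->
  measurable_fun setT f -> (forall x, 0 <= f x) ->
  \int[mu]_x f x = c%:E * \int[mu]_x f (c * x)%R.
Proof.
move=> c0 mf f0.
pose nu : {measure set (measurableTypeR R) -> \bar R} :=
  mscale (NngNum (ltW c0)) (pushforward mu
    (fun x : measurableTypeR R => (c * x)%R : measurableTypeR R)).
transitivity (\int[nu (mulc_measurable c)]_x f x).
  by apply: eq_measure_integral => A mA _; exact: lebesgue_measure_scale.
rewrite ge0_integral_mscale// ge0_integral_pushforward//; exact: mulc_measurable.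
Qed.

End scaling.

(** * Integration by parts for Gamma integrals *)

Section gamma_by_parts.
Context {R : realType}.
Local Notation mu := (@lebesgue_measure R).

Lemma lebesgue_tonelli (F : R * R -> \bar R) :
  measurable_fun setT F -> (forall z, 0 <= F z)%E ->
  (\int[mu]_v \int[mu]_u F (u, v) = \int[mu]_u \int[mu]_v F (u, v))%E.
Proof. by move=> mF F0; apply/esym; exact: (@fubini_tonelli _ _ _ _ _ mu mu). Qed.

Lemma integral_powR_itv (c v : R) : 1 <= c -> 0 < v ->
  (\int[mu]_(u in `]0%R, v[) (c * u `^ (c - 1))%:E = (v `^ c)%:E)%E.
Proof.
move=> c1 v0.
have c0 : 0 < c by exact: lt_le_trans c1.
have cf (a x : R) : 0 < x -> {for x, continuous (fun u : R => u `^ a)}.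
  move=> x0; apply/differentiable_continuous/derivable1_diffP.
  by apply: derivable_powR; rewrite in_itv/= x0.
(* Exponent 0, that is [c = 1], is included: the power is then constantly 1, also at the origin. *)
have powR0r (a : R) : 0 <= a -> x `^ a @[x --> 0^'+] --> (0 `^ a : R).
  rewrite le_eqVlt => /predU1P[<-|a0].
    by under eq_fun do rewrite powRr0; rewrite powRr0; exact: cvg_cst.
  by rewrite powR0 ?gt_eqF//; exact: powR_cvg0.
rewrite -(@integral_itv_bndoo _ 0 v _ true false); last first.
  exact/measurable_funTS/measurable_EFinP/measurable_funM.
rewrite (@continuous_FTC2 _ _ (fun x => x `^ c))//.
- by rewrite powR0 ?gt_eqF// sube0.
- apply/continuous_within_itvP => //; split.
  + move=> x; rewrite in_itv/= => /andP[x0 _].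
    by apply: cvgM; [exact: cvg_cst|exact: cf].
  + by apply: cvgM; [exact: cvg_cst|apply: powR0r; rewrite subr_ge0].
  + apply: cvgM; [exact: cvg_cst|apply: cvg_at_left_filter; exact: cf].
- split.
  + move=> x; rewrite in_itv/= => /andP[x0 _].
    by apply: derivable_powR; rewrite in_itv/= x0.
  + by apply: powR0r; exact: ltW.
  + by apply: cvg_at_left_filter; exact: cf.
- move=> x; rewrite in_itv/= => /andP[x0 _].
  by rewrite powR_derive1// in_itv/= x0.
Qed.

Lemma integral_expR_tail (b u : R) : 0 < b ->
  (\int[mu]_(v in `]u, +oo[) (b * expR (- b * v))%:E = (expR (- b * u))%:E)%E.
Proof.
move=> b0.
have cexp : continuous (fun z : R^o => expR (- b * z)).
  move=> z; apply: continuous_comp; last exact: continuous_expR.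
  by apply: continuousM => //; apply: (@continuousN _ R^o); exact: cst_continuous.
rewrite integral_itv_obnd_cbnd; last first.
  apply/measurable_funTS/measurable_EFinP/measurable_funM => //.
  by apply: measurableT_comp => //; exact: measurable_funM.
rewrite (@ge0_continuous_FTC2y _ _ (fun x => - (expR (- b * x))) _ 0)//.
- by rewrite EFinN oppeK add0e.
- by move=> x _; rewrite mulr_ge0 ?expR_ge0// ltW.
- apply: continuous_subspaceT => z.
  by apply: cvgM; [exact: cvg_cst|exact: cexp].
- rewrite -oppr0; apply: cvgN.
  rewrite (_ : (fun x => expR (- b * x)) =
               (fun z => expR (- z)) \o (fun z => b * z)); last first.
    by apply: eq_fun => x; rewrite mulNr.
  apply: (@cvg_comp _ _ _ _ _ _ (pinfty_nbhs R)); last exact: cvgr_expR.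
  exact: gt0_cvgMry.
- by apply: cvgN; apply/cvg_at_right_filter; exact: cexp.
- move=> z _.
  rewrite derive1_comp// derive1N// derive1_id mulN1r derive1_comp// derive1E.
  have /funeqP -> := @derive_expR R.
  by rewrite derive1Ml// derive1_id mulr1 mulrN opprK mulrC.
Qed.

(* Both sides are the integral of [c u^(c-1) b e^(-bv)] over [0 < u < v]. *)
Lemma gamma_by_parts (c b : R) : 1 <= c -> 0 < b ->
  (\int[mu]_(v in `]0%R, +oo[) (b * v `^ c * expR (- b * v))%:E =
   \int[mu]_(u in `]0%R, +oo[) (c * u `^ (c - 1) * expR (- b * u))%:E)%E.
Proof.
move=> c1 b0; have c0 : 0 < c by exact: lt_le_trans c1.
pose F (z : R * R) : \bar R := if 0 < z.1 < z.2 then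
  ((c * z.1 `^ (c - 1)) * (b * expR (- b * z.2)))%:E else 0%E.
have mpow : measurable_fun [set: R] (fun u : R => c * u `^ (c - 1)).
  by apply: measurable_funM => //; exact: measurable_powR.
have mexp : measurable_fun [set: R] (fun v : R => b * expR (- b * v)).
  by apply: measurable_funM => //; apply: measurableT_comp => //.
have mF : measurable_fun setT F.
  apply: measurable_fun_ifT => //.
    by apply: measurable_and; exact: measurable_fun_ltr.
  apply/measurable_EFinP/measurable_funM.
    exact: (measurableT_comp mpow).
  exact: (measurableT_comp mexp).
have F0 z : (0 <= F z)%E.
  rewrite /F; case: ifPn => // _; rewrite lee_fin !mulr_ge0 ?expR_ge0 ?powR_ge0//;
  exact: ltW.
(* Integrating in [v] first leaves an exponential tail and gives the right-hand side; integrating in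
   [u] first produces [v] to the power [c] and gives the left-hand side. *)
transitivity (\int[mu]_v \int[mu]_u F (u, v))%E; last first.
  rewrite lebesgue_tonelli// [RHS]integral_mkcond; apply: eq_integral => u _.
  rewrite patchE mem_setE in_itv/= andbT; case: ifPn => u0; last first.
    by apply: integral0_eq => v _; rewrite /F/= (negbTE u0).
  transitivity (\int[mu]_(v in `]u, +oo[)
     ((c * u `^ (c - 1))%:E * (b * expR (- b * v))%:E))%E.
    rewrite [RHS]integral_mkcond; apply: eq_integral => v _.
    by rewrite patchE mem_setE in_itv/= andbT /F/= u0.
  rewrite ge0_integralZl_EFin//.
  - by rewrite integral_expR_tail.
  - by move=> v _; rewrite lee_fin mulr_ge0 ?expR_ge0// ltW.
  - exact/measurable_funTS/measurable_EFinP.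
  - by rewrite mulr_ge0 ?powR_ge0// ltW.
rewrite integral_mkcond; apply: eq_integral => v _.
rewrite patchE mem_setE in_itv/= andbT; case: ifPn => v0; last first.
  apply/esym/integral0_eq => u _; rewrite /F/=; case: ifPn => // /andP[u0 uv].
  by move: v0; rewrite (lt_trans u0 uv).
transitivity (\int[mu]_(u in `]0%R, v[)
   ((b * expR (- b * v))%:E * (c * u `^ (c - 1))%:E))%E; last first.
  rewrite integral_mkcond; apply: eq_integral => u _.
  by rewrite patchE mem_setE in_itv/= /F/=; case: ifPn => // _; rewrite -EFinM mulrC.
rewrite ge0_integralZl_EFin//.
- by rewrite integral_powR_itv// -EFinM mulrAC.
- by move=> u _; rewrite lee_fin mulr_ge0 ?powR_ge0// ltW.
- exact/measurable_funTS/measurable_EFinP.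
- by rewrite mulr_ge0 ?expR_ge0// ltW.
Qed.

End gamma_by_parts.

(** * Chi-squared densities and Euler's identity *)

Section chi2.
Context {R : realType}.
Local Notation mu := (@lebesgue_measure R).

(** On each half-line the inverse is, up to sign, the real power with exponent -1; at the origin
    both take the value 0. *)
Lemma measurable_inv : measurable_fun [set: R] (@GRing.inv R).
Proof.
rewrite (_ : GRing.inv = fun x : R =>
    if 0 <= x then x `^ (-1) else - ((- x) `^ (-1))); last first.
  apply/funext => x; case: ifPn => [x0|]; first by rewrite powR_inv1.
  by rewrite -ltNge => x0; rewrite powR_inv1 ?oppr_ge0 ?ltW// invrN opprK.
apply: measurable_fun_ifT => //; first exact: measurable_fun_ler.
apply: measurableT_comp => //.
exact: (measurableT_comp (@measurable_powR R (-1))).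
Qed.

Lemma measurable_fun_div d (T : measurableType d) (f g : T -> R) :
  measurable_fun setT f -> measurable_fun setT g ->
  measurable_fun setT (fun x => f x / g x).
Proof.
move=> mf mg; apply: measurable_funM => //.
exact: (measurableT_comp measurable_inv).
Qed.

Lemma measurable_chi2_pdf (m : nat) : measurable_fun setT (@chi2_pdf R m).
Proof.
apply: measurable_fun_ifT => //; first exact: measurable_fun_ltr.
apply: measurable_funM => //; apply: measurable_funM => //.
by apply: measurableT_comp => //; apply: measurableT_comp => //; exact: measurable_funM.
Qed.

Lemma Gamma_ge0 (a : R) : 0 <= Gamma a.
Proof. by apply: Rintegral_ge0 => x _; rewrite mulr_ge0 ?powR_ge0 ?expR_ge0. Qed.

(** The Gamma integral is never evaluated: this section uses only that the constant is nonnegative,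
    and [chi2_cst_gt0] later derives positivity from the total mass of the model. *)
Definition chi2_cst (m : nat) : R := (2 `^ (m%:R / 2) * Gamma (m%:R / 2))^-1.

Lemma chi2_cst_ge0 m : 0 <= chi2_cst m.
Proof. by rewrite invr_ge0 mulr_ge0 ?powR_ge0 ?Gamma_ge0. Qed.

Lemma chi2_pdfE m (x : R) : 0 < x ->
  chi2_pdf m x = x `^ (m%:R / 2 - 1) * expR (- (x / 2)) * chi2_cst m.
Proof. by rewrite /chi2_pdf => ->. Qed.

Lemma chi2_pdf_le0 m (x : R) : x <= 0 -> chi2_pdf m x = 0.
Proof. by rewrite /chi2_pdf ltNge => ->. Qed.

Lemma chi2_pdf_ge0 m (x : R) : 0 <= chi2_pdf m x.
Proof.
have [x0|x0] := ltP 0 x; last by rewrite chi2_pdf_le0.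
by rewrite chi2_pdfE// !mulr_ge0 ?powR_ge0 ?expR_ge0 ?chi2_cst_ge0.
Qed.

Lemma chi2_pdf_gt0 m (x : R) : 0 < chi2_cst m -> 0 < x -> 0 < chi2_pdf m x.
Proof. by move=> m0 x0; rewrite chi2_pdfE// !mulr_gt0 ?powR_gt0 ?expR_gt0. Qed.

Lemma measurable_chi2_ratio (m1 m2 k j : nat) (u : R -> R) :
  measurable_fun setT u -> measurable_fun setT (fun v : R * R =>
    u (v.2 / v.1) * v.1 ^+ k * (v.1 + v.2) ^+ j
      * (chi2_pdf m1 v.1 * chi2_pdf m2 v.2)).
Proof.
move=> mu_; apply: measurable_funM.
  apply: measurable_funM.
    apply: measurable_funM; last exact: measurable_funX.
    by apply: measurableT_comp => //; exact: measurable_fun_div.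
  exact/measurable_funX/measurable_funD.
by apply: measurable_funM;
  apply: measurableT_comp => //; exact: measurable_chi2_pdf.
Qed.

(* The substitution [y = z x] followed by Tonelli's theorem. *)
Lemma chi2_ratio_integral (m1 m2 k j : nat) (u : R -> R) :
  measurable_fun setT u -> (forall z, 0 <= u z) ->
  (\int[mu]_x \int[mu]_y (u (y / x) * x ^+ k * (x + y) ^+ j
     * (chi2_pdf m1 x * chi2_pdf m2 y))%:E =
   \int[mu]_(z in `]0%R, +oo[)
    ((chi2_cst m1 * chi2_cst m2 * u z * z `^ (m2%:R / 2 - 1) * (1 + z) ^+ j)%:E
    * \int[mu]_(x in `]0%R, +oo[)
        (x `^ ((m1 + m2)%:R / 2 + k%:R - 1 + j%:R)
           * expR (- ((1 + z) / 2) * x))%:E))%E.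
Proof.
move=> mu_ u0.
pose h (z : R) := chi2_cst m1 * chi2_cst m2 * u z * z `^ (m2%:R / 2 - 1)
  * (1 + z) ^+ j.
pose g (v : R * R) := v.1 `^ ((m1 + m2)%:R / 2 + k%:R - 1 + j%:R)
  * expR (- ((1 + v.2) / 2) * v.1).
(* Here [v.1] is [x] and [v.2] is the ratio [z]; outside the open quadrant at least one density
   vanishes. *)
pose G (v : R * R) : \bar R :=
  if (0 < v.1) && (0 < v.2) then (h v.2 * g v)%:E else 0%E.
have mh : measurable_fun setT h.
  apply: measurable_funM; last exact/measurable_funX/measurable_funD.
  by apply: measurable_funM => //; exact: measurable_funM.
have mg : measurable_fun setT g.
  apply: measurable_funM.
    exact: (measurableT_comp (@measurable_powR R _)).
  apply: measurableT_comp => //; apply: measurable_funM => //.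
  apply: measurableT_comp => //; apply: measurable_funM => //.
  exact: measurable_funD.
have mG : measurable_fun setT G.
  apply: measurable_fun_ifT => //.
    by apply: measurable_and; exact: measurable_fun_ltr.
  by apply/measurable_EFinP/measurable_funM => //; exact: (measurableT_comp mh).
have h0 z : 0 < z -> 0 <= h z.
  by move=> z0; rewrite !mulr_ge0 ?chi2_cst_ge0 ?powR_ge0 ?exprn_ge0 ?addr_ge0// ltW.
have g0 v : 0 <= g v by rewrite mulr_ge0 ?powR_ge0 ?expR_ge0.
have G0 v : (0 <= G v)%E.
  by rewrite /G; case: ifPn => // /andP[_ ?]; rewrite lee_fin mulr_ge0 ?h0.
transitivity (\int[mu]_z \int[mu]_x G (x, z))%E; last first.
  rewrite [RHS]integral_mkcond; apply: eq_integral => z _.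
  rewrite patchE mem_setE in_itv/= andbT; case: ifPn => z0; last first.
    by apply: integral0_eq => x _; rewrite /G/= (negbTE z0) andbF.
  rewrite -ge0_integralZl_EFin//; last 3 first.
  - by move=> x _; rewrite lee_fin (g0 (x, z)).
  - apply/measurable_funTS/measurable_EFinP.
    exact: (measurableT_comp mg (pair2_measurable z)).
  - exact: h0.
  rewrite [RHS]integral_mkcond; apply: eq_integral => x _.
  by rewrite patchE mem_setE in_itv/= andbT /G/= z0 andbT; case: ifPn.
rewrite lebesgue_tonelli//; apply: eq_integral => x _.
have [x0|x0] := ltP 0 x; last first.
  rewrite integral0_eq => [|y _]; last by rewrite chi2_pdf_le0// mul0r mulr0.
  by rewrite integral0_eq// => z _; rewrite /G/= ltNge x0.
have mf : measurable_fun setT (fun y : R => (u (y / x) * x ^+ k * (x + y) ^+ j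
     * (chi2_pdf m1 x * chi2_pdf m2 y))%:E).
  apply/measurable_EFinP.
  have := measurableT_comp (measurable_chi2_ratio m1 m2 k j u mu_) (pair1_measurable (x : R)).
  by apply.
(* This agrees with the integrand everywhere, since the second density vanishes for [y <= 0], and is
   visibly nonnegative, as the change of variables requires. *)
pose f (y : R) : R := if 0 < y then u (y / x) * x ^+ k * (x + y) ^+ j
     * (chi2_pdf m1 x * chi2_pdf m2 y) else 0.
have fE y : f y = u (y / x) * x ^+ k * (x + y) ^+ j
     * (chi2_pdf m1 x * chi2_pdf m2 y).
  by rewrite /f; case: ltP => // y0; rewrite (chi2_pdf_le0 m2)// !mulr0.
have mf' : measurable_fun setT (fun y : R => (f y)%:E).
  by rewrite (funext fE).
have f0 y : 0 <= f y.
  rewrite /f; case: ifPn => // y0.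
  by rewrite !mulr_ge0 ?chi2_pdf_ge0 ?exprn_ge0 ?addr_ge0// ltW.
under eq_integral do rewrite -fE.
rewrite [LHS](ge0_integral_scale x (fun y => (f y)%:E))// -ge0_integralZl_EFin ?ltW//; first last.
- exact: (measurableT_comp mf' (@mulrl_measurable R setT x)).
- by move=> y _; rewrite lee_fin.
apply: eq_integral => z _; rewrite /G/= x0/=.
have [z0|z0] := ltP 0 z; last by rewrite /f ltNge pmulr_rle0// z0/= mule0.
rewrite -EFinM; congr EFin; rewrite fE /h /g/= !chi2_pdfE ?mulr_gt0//.
rewrite [x * z / x]mulrAC divff ?gt_eqF// mul1r powRM ?ltW//.
have -> : x + x * z = x * (1 + z) by rewrite mulrDr mulr1.
rewrite exprMn.
(* The exponent of [x] collects the two densities, the Jacobian [x], and the factors [x ^+ k] and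
   [(x * (1 + z)) ^+ j]. *)
have -> : (m1 + m2)%:R / 2 + k%:R - 1 + j%:R =
   (m1%:R / 2 - 1) + ((m2%:R / 2 - 1) + (1 + (k%:R + j%:R))) :> R.
  by rewrite natrD; field.
have xD r s : x `^ (r + s) = x `^ r * x `^ s.
  by rewrite powRD//; apply/implyP => _; rewrite gt_eqF.
rewrite !xD powRr1 ?ltW// !powR_mulrn ?ltW//.
have -> : - ((1 + z) / 2) * x = - (x / 2) + - (x * z / 2) by field.
by rewrite expRD; ring.
Qed.

(* In the coordinates [(x, z = y / x)] this is integration by parts in [x] alone. *)
Lemma chi2_euler (m1 m2 k : nat) (u : R -> R) : (0 < m1)%N -> (0 < m2)%N ->
  measurable_fun setT u -> (forall z, 0 <= u z) ->
  (\int[mu]_x \int[mu]_y (u (y / x) * x ^+ k * (x + y)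
     * (chi2_pdf m1 x * chi2_pdf m2 y))%:E =
   \int[mu]_x \int[mu]_y ((m1 + m2 + k.*2)%:R * u (y / x) * x ^+ k
     * (chi2_pdf m1 x * chi2_pdf m2 y))%:E)%E.
Proof.
move=> m10 m20 mu_ u0.
have := @chi2_ratio_integral m1 m2 k 1 u mu_ u0.
under eq_integral do under eq_integral do rewrite expr1.
move=> ->.
have := @chi2_ratio_integral m1 m2 k 0 (fun z => (m1 + m2 + k.*2)%:R * u z).
under eq_integral do under eq_integral do rewrite expr0 mulr1.
move=> ->; last 2 first.
- exact: measurable_funM.
- by move=> z; rewrite mulr_ge0.
(* The exponent of [x] is [c] when the factor [x + y] is present ([j = 1]) and [c - 1] when it is
   absent ([j = 0]); the two positive degrees of freedom give [1 <= c]. *)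
set c : R := (m1 + m2)%:R / 2 + k%:R.
have c1 : 1 <= c.
  rewrite /c -[leLHS]addr0 lerD// ler_pdivlMr// mul1r ler_nat.
  by rewrite -[2%N]/(1 + 1)%N leq_add.
apply: eq_integral => z; rewrite inE/= in_itv/= andbT => z0.
have b0 : 0 < (1 + z) / 2 by rewrite divr_gt0// addr_gt0.
have mgam (a : R) : measurable_fun [set: R]
    (fun x : R => (x `^ a * expR (- ((1 + z) / 2) * x))%:E).
  apply/measurable_EFinP/measurable_funM; first exact: measurable_powR.
  by apply: measurableT_comp => //; exact: measurable_funM.
have gam0 (a x : R) : (0 <= (x `^ a * expR (- ((1 + z) / 2) * x))%:E)%E.
  by rewrite lee_fin mulr_ge0 ?powR_ge0 ?expR_ge0.
have := gamma_by_parts _ _ c1 b0.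
under eq_integral do rewrite -mulrA EFinM.
under [in RHS]eq_integral do rewrite -mulrA EFinM.
rewrite ge0_integralZl_EFin//; last 2 first.
- exact: (measurable_funTS (mgam _)).
- exact: ltW.
rewrite ge0_integralZl_EFin//; last 2 first.
- exact: (measurable_funTS (mgam _)).
- exact: le_trans c1.
rewrite subrK addr0 expr1 expr0 mulr1 => byparts.
set A := (X in (_ = _ * X)%E).
(* The factor [1 + z] is twice the exponential rate, which integration by parts trades for [c];
   twice [c] is [m1 + m2 + k.*2]. *)
have -> : chi2_cst m1 * chi2_cst m2 * u z * z `^ (m2%:R / 2 - 1) * (1 + z) =
  (2 * (chi2_cst m1 * chi2_cst m2 * u z * z `^ (m2%:R / 2 - 1))) * ((1 + z) / 2).
  by field.
rewrite EFinM -muleA byparts muleA -EFinM; congr (_%:E * _)%E.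
by rewrite /c -addnn !natrD; field.
Qed.

End chi2.

(** * Uniqueness of finite measures on a product *)

Section rectangles.
Local Open Scope ereal_scope.

(** Rectangles form a generating pi-system that contains the whole space, so the constant exhaustion
    by [setT] suffices. *)
Lemma finite_measure_eq_rectangles {d1 d2} {T1 : measurableType d1}
    {T2 : measurableType d2} {R : realType}
    (n1 n2 : {measure set (T1 * T2) -> \bar R}) : n1 setT < +oo ->
  (forall A B, measurable A -> measurable B -> n1 (A `*` B) = n2 (A `*` B)) ->
  forall X : set (T1 * T2), measurable X -> n1 X = n2 X.
Proof.
move=> n1T n12 X mX.
apply: (measure_unique [set A `*` B | A in measurable & B in measurable]
  (fun=> setT)) => //.
- by rewrite measurable_prod_measurableType.
- move=> _ _ [A1 mA1 [A2 mA2 <-]] [B1 mB1 [B2 mB2 <-]].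
  exists (A1 `&` B1); first exact: measurableI.
  exists (A2 `&` B2); first exact: measurableI.
  by rewrite setXI.
- by move=> _; exists setT => //; exists setT => //; rewrite setXTT.
- by apply/seteqP; split => // x _; exists 0%N.
- by move=> _ [A mA [B mB <-]]; exact: n12.
Qed.

End rectangles.

(** * Lebesgue measure on the plane *)

Section plane.
Context {R : realType}.
Local Notation mR := (measurableTypeR R).
Local Notation mu := (@lebesgue_measure R).

(** Named in order to carry a sigma-finite structure, on which the product [Pi \x leb2] and its
    iterated integrals rely. *)
Definition leb2 : set (mR * mR) -> \bar R := (mu \x mu)%E.

HB.instance Definition _ := Measure.on leb2.

Let leb2_sigma_finite : sigma_finite setT leb2.
Proof.
have /sigma_finiteP[F [TF ndF Foo]] := sigma_finiteT mu.
exists (fun n => F n `*` F n).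
  apply/seteqP; split=> // -[x y] _.
  have [[n _ Fx] [k _ Fy]] : (\bigcup_i F i) x /\ (\bigcup_i F i) y by rewrite -TF.
  exists (maxn n k) => //; split => /=.
  - by move: x Fx; exact/subsetPset/ndF/leq_maxl.
  - by move: y Fy; exact/subsetPset/ndF/leq_maxr.
move=> n; have [mF Fn] := Foo n; split; first exact: measurableX.
by rewrite /leb2 product_measure1E// lte_mul_pinfty// ge0_fin_numE.
Qed.

HB.instance Definition _ :=
  Measure_isSigmaFinite.Build _ _ _ leb2 leb2_sigma_finite.

Lemma leb2_tonelli (f : mR * mR -> \bar R) : measurable_fun setT f ->
  (forall v, 0 <= f v)%E ->
  (\int[leb2]_v f v = \int[mu]_x \int[mu]_y f (x, y))%E.
Proof. by move=> mf f0; exact: (@fubini_tonelli1 _ _ _ _ _ mu mu). Qed.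

End plane.

(** * The joint law of [(S1, S2)] as a scale mixture *)

Section scale_mixture_law.
Context {R : realType} {d : measure_display} {T : measurableType d}.
Local Notation mu := (@lebesgue_measure R).
Variables (Pi : probability R R) (P : probability T R) (S1 S2 : {mfun T >-> R}).
Variables (c1 c2 : R) (m1 m2 : nat).
Local Open Scope ereal_scope.

(** This is all that the risks use of the model: the normal vectors and the mixing variable have
    been integrated out. *)
Definition scale_mixture_rectangles : Prop := forall C1 C2 : set R,
  measurable C1 -> measurable C2 ->
  P (S1 @^-1` C1 `&` S2 @^-1` C2) =
  \int[Pi]_(t in `]0%R, +oo[) (scaled_chi2_prob (c1 / t)%R m1 C1
    * scaled_chi2_prob (c2 / t)%R m2 C2).

Local Notation RR := (R * (measurableTypeR R * measurableTypeR R))%type.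

(** The function [w] below is the density, with respect to [M], of the mixing variable together with
    two independent chi-squared variables, and [G] sends such a triple to the scaled pair. The law
    of [(S1, S2)] is identified with the image of that measure under [G]. *)
Let M : {measure set RR -> \bar R} := (Pi \x leb2).

Let w (p : RR) : R :=
  ((if 0 < p.1 then 1 else 0) * (chi2_pdf m1 p.2.1 * chi2_pdf m2 p.2.2))%R.

Let mw : measurable_fun setT w.
Proof.
apply: measurable_funM.
  by apply: measurable_fun_ifT => //; exact: measurable_fun_ltr.
by apply: measurable_funM;
  (apply: measurableT_comp; first exact: measurable_chi2_pdf);
  apply: measurableT_comp.
Qed.

Let w0 p : (0 <= w p)%R.
Proof. by rewrite /w !mulr_ge0 ?chi2_pdf_ge0//; case: ifPn. Qed.

HB.instance Definition _ := isMeasurableFun.Build _ _ _ _ w mw.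

Let G (p : RR) : R * R := (c1 / p.1 * p.2.1, c2 / p.1 * p.2.2)%R.

Let mG : measurable_fun setT G.
Proof.
apply: measurable_fun_pair => /=; apply: measurable_funM.
- exact: measurable_fun_div.
- exact: measurableT_comp.
- exact: measurable_fun_div.
- exact: measurableT_comp.
Qed.

Let integral_mix (f : R * R -> R) : measurable_fun setT f ->
  (forall s, 0 <= f s)%R ->
  \int[mdensity M w]_p (f (G p))%:E =
  \int[Pi]_(t in `]0%R, +oo[) \int[leb2]_v
    (f (c1 / t * v.1, c2 / t * v.2) * (chi2_pdf m1 v.1 * chi2_pdf m2 v.2))%:E.
Proof.
move=> mf f0.
have mfG : measurable_fun setT (fun p => (f (G p) * w p)%:E).
  by apply/measurable_EFinP/measurable_funM => //; exact: (measurableT_comp mf mG).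
rewrite ge0_integral_mdensity; last 2 first.
- by apply/measurable_EFinP; exact: (measurableT_comp mf mG).
- by move=> p; rewrite lee_fin.
transitivity (\int[M]_p (f (G p) * w p)%:E).
  by apply: eq_integral => p _; rewrite -EFinM ger0_norm.
rewrite /M fubini_tonelli1//; last by move=> p; rewrite lee_fin mulr_ge0.
rewrite /fubini_F [RHS]integral_mkcond; apply: eq_integral => t _.
rewrite patchE mem_setE in_itv/= andbT; case: ifPn => t0; last first.
  by apply: integral0_eq => v _; rewrite /w/= (negbTE t0) mul0r mulr0.
by apply: eq_integral => v _; rewrite /w/= t0 mul1r.
Qed.

Let scaled_chi2E (c : R) m (A : set R) : measurable A ->
  scaled_chi2_prob c m A = \int[mu]_x (\1_A (c * x)%R * chi2_pdf m x)%:E.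
Proof.
move=> mA; rewrite /scaled_chi2_prob /chi2_prob integral_mkcond.
apply: eq_integral => x _; rewrite patchE indicE.
have -> : (x \in (fun v => (c * v)%R) @^-1` A) = ((c * x)%R \in A) by [].
by case: (_ \in A); rewrite ?mul1r ?mul0r.
Qed.

(** The law of [(S1, S2)] and the image of the weighted measure under [G] agree on rectangles, hence
    on all measurable sets, hence as integrals. *)
Lemma scale_mixture_integral (f : R * R -> R) : scale_mixture_rectangles ->
  measurable_fun setT f -> (forall s, 0 <= f s)%R ->
  \int[P]_x (f (S1 x, S2 x))%:E =
  \int[Pi]_(t in `]0%R, +oo[) \int[leb2]_v
    (f (c1 / t * v.1, c2 / t * v.2) * (chi2_pdf m1 v.1 * chi2_pdf m2 v.2))%:E.
Proof.
move=> rect mf f0.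
have mS : measurable_fun setT (fun x => (S1 x, S2 x)) by exact: measurable_fun_pair.
pose n1 : {measure set (R * R) -> \bar R} := pushforward P (fun x => (S1 x, S2 x)).
pose n2 : {measure set (R * R) -> \bar R} := pushforward (mdensity M w) G.
have mEf : measurable_fun setT (fun s => (f s)%:E) by exact/measurable_EFinP.
transitivity (\int[n1 mS]_s (f s)%:E).
  rewrite ge0_integral_pushforward//.
  by move=> s _; rewrite lee_fin.
transitivity (\int[n2 mG]_s (f s)%:E); last first.
  rewrite ge0_integral_pushforward//; last by move=> s _; rewrite lee_fin.
  exact: integral_mix.
apply: eq_measure_integral => X mX _.
apply: finite_measure_eq_rectangles => // [|A B mA mB].
  rewrite /n1/= /pushforward preimage_setT probability_setT ltry//.
rewrite /n1 /n2 /= /pushforward.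
have -> : (fun x => (S1 x, S2 x)) @^-1` (A `*` B) = S1 @^-1` A `&` S2 @^-1` B by [].
rewrite rect//.
have mAB : measurable (A `*` B) by exact: measurableX.
(* The measure of a rectangle is the integral of its indicator, so [integral_mix] computes it and
   Tonelli's theorem splits it into two chi-squared probabilities. *)
transitivity (\int[mdensity M w]_p (\1_(A `*` B) (G p))%:E); last first.
  transitivity (\int[mdensity M w]_p (\1_(G @^-1` (A `*` B)) p)%:E) => //.
  rewrite integral_indic ?setIT// -(setTI (G @^-1` _)); exact: mG.
rewrite integral_mix//.
apply: eq_integral => t _.
have mi (c : R) m (C : set R) : measurable C ->
    measurable_fun [set: R] (fun x : R => (\1_C (c * x)%R * chi2_pdf m x)%R).
  move=> mC; apply: measurable_funM; last exact: measurable_chi2_pdf.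
  exact: (measurableT_comp (@measurable_indic _ _ R setT C mC)
    (@mulrl_measurable R setT c)).
have i0 (c : R) m (C : set R) x : (0 <= \1_C (c * x)%R * chi2_pdf m x)%R.
  by rewrite mulr_ge0 ?chi2_pdf_ge0.
rewrite !scaled_chi2E//.
transitivity (\int[leb2]_v ((\1_A (c1 / t * v.1) * chi2_pdf m1 v.1)
   * (\1_B (c2 / t * v.2) * chi2_pdf m2 v.2))%:E); last first.
  apply: eq_integral => v _; congr EFin.
  rewrite !indicE in_setX/=.
  by case: (_ \in A); case: (_ \in B); rewrite ?mul1r ?mul0r ?mulr0 ?mul0r.
rewrite leb2_tonelli//; last 2 first.
- apply/measurable_EFinP/measurable_funM.
    exact: (measurableT_comp (mi _ _ _ mA)).
  exact: (measurableT_comp (mi _ _ _ mB)).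
- by move=> v; rewrite lee_fin mulr_ge0 ?i0.
rewrite -ge0_integralZr//; last 3 first.
- by apply/measurable_EFinP; exact: mi.
- by move=> x _; rewrite lee_fin i0.
- by apply: integral_ge0 => x _; rewrite lee_fin i0.
apply: eq_integral => x _.
rewrite -ge0_integralZl_EFin//.
- by move=> y _; rewrite lee_fin i0.
- by apply/measurable_EFinP; exact: mi.
Qed.

End scale_mixture_law.

(** * Strict comparison of integrals *)

Section integral_comparison.
Context {d : measure_display} {T : measurableType d} {R : realType}.
Local Open Scope ereal_scope.

(** A zero integral would make [h] vanish almost everywhere and so put [D] inside a null set. *)
Lemma integral_gt0 (nu : {measure set T -> \bar R}) (D : set T) (h : T -> R) :
  measurable D -> 0 < nu D -> measurable_fun setT h ->
  (forall x, 0 <= h x)%R -> (forall x, D x -> 0 < h x)%R ->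
  0 < \int[nu]_x (h x)%:E.
Proof.
move=> mD nuD mh h0 hD.
have mEh : measurable_fun setT (fun x => (h x)%:E) by exact/measurable_EFinP.
rewrite lt_neqAle integral_ge0 ?andbT; last by move=> x _; rewrite lee_fin.
apply/negP => /eqP/esym int0.
have : \int[nu]_x `|(h x)%:E| = 0.
  by rewrite -[RHS]int0; apply: eq_integral => x _; rewrite gee0_abs// lee_fin.
move=> /ae_eq_integral_abs => /(_ measurableT mEh)[N [mN N0 hN]].
have DN : D `<=` N.
  move=> x Dx; apply: hN => /= /(_ Logic.I) [] hx0.
  by have := hD x Dx; rewrite hx0 ltxx.
by have := le_measure nu (mem_set mD) (mem_set mN) DN; rewrite [X in _ <= X]N0 leNgt nuD.
Qed.

(** Write [g] as [f + (g - f)]: adding the positive integral of [g - f] is strict because the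
    integral of [f] is finite, while that of [g] may be infinite. *)
Lemma lt_ge0_integral (nu : {measure set T -> \bar R}) (D : set T) (f g : T -> R) :
  measurable D -> 0 < nu D -> measurable_fun setT f -> measurable_fun setT g ->
  (forall x, 0 <= f x <= g x)%R -> (forall x, D x -> f x < g x)%R ->
  \int[nu]_x (f x)%:E < +oo ->
  \int[nu]_x (f x)%:E < \int[nu]_x (g x)%:E.
Proof.
move=> mD nuD mf mg fg fgD foo.
have f0 x : (0 <= f x)%R by have /andP[] := fg x.
have h0 x : (0 <= g x - f x)%R by rewrite subr_ge0; have /andP[] := fg x.
have -> : \int[nu]_x (g x)%:E = \int[nu]_x (f x)%:E + \int[nu]_x (g x - f x)%:E.
  rewrite -ge0_integralD//.
  - by apply: eq_integral => x _; rewrite -EFinD addrC subrK.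
  - by move=> x _; rewrite lee_fin.
  - exact/measurable_EFinP.
  - by move=> x _; rewrite lee_fin.
  - exact/measurable_EFinP/measurable_funB.
rewrite lteDl.
  apply: (@integral_gt0 _ D) => //; first exact: measurable_funB.
  by move=> x Dx; rewrite subr_gt0 fgD.
by rewrite ge0_fin_numE// integral_ge0// => x _; rewrite lee_fin.
Qed.

Lemma integral_full_event (P : probability T R) (D : set T) (f : T -> \bar R) :
  measurable D -> P D = 1 -> measurable_fun setT f ->
  \int[P]_x f x = \int[P]_(x in D) f x.
Proof.
move=> mD PD mf; rewrite [RHS]integral_mkcond.
apply: ae_eq_integral => //.
  by apply/(measurable_restrictT _ _).1 => //; exact: measurable_funTS.
exists (~` D); split; first exact: measurableC.
  by rewrite /= probability_setC// PD subee.
by move=> x; apply: contra_not => Dx _; rewrite patchE mem_set.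
Qed.

(** Finiteness of the integrals of [L0] and [B] forces, through the balance identity, that of [L1]
    and [A], so subtraction is legitimate. Signs and balance are required on [D] only, because the
    losses are not controlled elsewhere. *)
Lemma lt_expectation_balance (P : probability T R) (D : set T)
    (L0 L1 A B : T -> R) :
  measurable D -> P D = 1 ->
  measurable_fun setT L0 -> measurable_fun setT L1 ->
  measurable_fun setT A -> measurable_fun setT B ->
  (forall x, D x -> [/\ 0 <= L0 x, 0 <= L1 x, 0 <= A x & 0 <= B x])%R ->
  (forall x, D x -> L1 x + A x = L0 x + B x)%R ->
  \int[P]_x (L0 x)%:E < +oo ->
  \int[P]_(x in D) (B x)%:E < +oo ->
  \int[P]_(x in D) (B x)%:E < \int[P]_(x in D) (A x)%:E ->
  \int[P]_x (L1 x)%:E < \int[P]_x (L0 x)%:E.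
Proof.
move=> mD PD mL0 mL1 mA mB ge0 balance.
have mE (f : T -> R) : measurable_fun setT f -> measurable_fun setT (fun x => (f x)%:E).
  by move=> mf; exact/measurable_EFinP.
rewrite (@integral_full_event P D (fun x => (L0 x)%:E))//; last exact: mE.
rewrite (@integral_full_event P D (fun x => (L1 x)%:E))//; last exact: mE.
move=> L0oo Boo BA.
have : \int[P]_(x in D) (L1 x)%:E + \int[P]_(x in D) (A x)%:E =
       \int[P]_(x in D) (L0 x)%:E + \int[P]_(x in D) (B x)%:E.
  rewrite -!ge0_integralD//.
  - by apply: eq_integral => x /set_mem Dx; rewrite -!EFinD balance.
  - by move=> x /ge0[? ? ? ?]; rewrite lee_fin.
  - exact/measurable_funTS/mE.
  - by move=> x /ge0[? ? ? ?]; rewrite lee_fin.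
  - exact/measurable_funTS/mE.
  - by move=> x /ge0[? ? ? ?]; rewrite lee_fin.
  - exact/measurable_funTS/mE.
  - by move=> x /ge0[? ? ? ?]; rewrite lee_fin.
  - exact/measurable_funTS/mE.
have i0 (f : T -> R) : (forall x, D x -> 0 <= f x)%R -> 0 <= \int[P]_(x in D) (f x)%:E.
  by move=> f0; apply: integral_ge0 => x Dx; rewrite lee_fin f0.
have l0 : 0 <= \int[P]_(x in D) (L0 x)%:E by apply: i0 => x /ge0[].
have l1 : 0 <= \int[P]_(x in D) (L1 x)%:E by apply: i0 => x /ge0[].
have b0 : 0 <= \int[P]_(x in D) (B x)%:E by apply: i0 => x /ge0[].
move: l0 l1 b0 L0oo Boo BA.
move: (\int[P]_(x in D) (L0 x)%:E) => [l0||]//.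
move: (\int[P]_(x in D) (L1 x)%:E) => [l1||]//.
  move: (\int[P]_(x in D) (B x)%:E) => [b||]//.
  move: (\int[P]_(x in D) (A x)%:E) => [a||]//.
  rewrite -!EFinD !lte_fin => _ _ _ _ _ ba [e]; lra.
move: (\int[P]_(x in D) (B x)%:E) => [b||]//.
by move: (\int[P]_(x in D) (A x)%:E) => [a||].
Qed.

End integral_comparison.

(** * Inverse moments of the mixing distribution *)

Section inverse_moments.
Context {R : realType}.
Variable Pi : probability R R.
Hypothesis Pi_pos : Pi `]0, +oo[%classic = 1%E.

Lemma measurable_exprVn (k : nat) : measurable_fun setT (fun t : R => t ^- k).
Proof. by apply: (measurableT_comp measurable_inv); exact: measurable_funX. Qed.

(** The zeroth moment makes the entropy loss the case [k = 0] of the general comparison. *)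
Lemma integrable_inv_moment0 : Pi.-integrable setT (fun t : R => (t ^- 0)%:E).
Proof.
apply: (eq_integrable _ (cst 1%E)) => //.
  by move=> t _; rewrite expr0 invr1.
exact: finite_measure_integrable_cst.
Qed.

Lemma inv_moment0 : inv_moment Pi 0 = 1.
Proof.
rewrite /inv_moment; under eq_Rintegral do rewrite expr0 invr1.
by rewrite Rintegral_cst// mul1r [X in fine X]probability_setT.
Qed.

Lemma integral_pos_inv_moment (k : nat) :
  Pi.-integrable setT (fun t : R => (t ^- k)%:E) ->
  (\int[Pi]_(t in `]0%R, +oo[) (t ^- k)%:E = (inv_moment Pi k)%:E)%E.
Proof.
move=> ik; rewrite /inv_moment /Rintegral fineK; last exact: integrable_fin_num.
apply/esym/integral_full_event => //.
by apply/measurable_EFinP; exact: measurable_exprVn.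
Qed.

Lemma inv_moment_gt0 (k : nat) :
  Pi.-integrable setT (fun t : R => (t ^- k)%:E) -> 0 < inv_moment Pi k.
Proof.
move=> ik; rewrite -lte_fin -integral_pos_inv_moment// integral_mkcond.
have -> : (fun t : R => (t ^- k)%:E) \_ `]0, +oo[ =
    (fun t : R => (if 0 < t then t ^- k else 0)%:E).
  apply/funext => t; rewrite patchE mem_setE in_itv/= andbT; by case: ifPn.
apply: (@integral_gt0 _ _ _ Pi `]0, +oo[%classic) => //.
- by rewrite [ltRHS]Pi_pos.
- apply: measurable_fun_ifT => //; first exact: measurable_fun_ltr.
  exact: measurable_exprVn.
- by move=> t; case: ifPn => // t0; rewrite invr_ge0 exprn_ge0// ltW.
- by move=> t /=; rewrite in_itv/= andbT => t0; rewrite t0 invr_gt0 exprn_gt0.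
Qed.

End inverse_moments.

(** * Comparison of moments under the scale mixture *)

Section scale_mixture_comparison.
Context {R : realType} {d : measure_display} {T : measurableType d}.
Variables (Pi : probability R R) (P : probability T R) (S1 S2 : {mfun T >-> R}).
Hypothesis Pi_pos : Pi `]0, +oo[%classic = 1%E.
Variables (c1 c2 : R) (m1 m2 : nat).
Hypotheses (c1_gt0 : 0 < c1) (c2_gt0 : 0 < c2).
Hypothesis rect : scale_mixture_rectangles Pi P S1 S2 c1 c2 m1 m2.
Local Notation chi2_pdf2 v := (chi2_pdf m1 v.1 * chi2_pdf m2 v.2).

(** Losses are compared on this event: elsewhere the ratio and the logarithm may take default
    values. *)
Definition pos_event : set T := [set x | 0 < S1 x /\ 0 < S2 x].

Lemma pos_eventE : pos_event = S1 @^-1` `]0, +oo[ `&` S2 @^-1` `]0, +oo[.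
Proof.
by apply/seteqP; split => x [] /=; rewrite /= !in_itv/= !andbT => ? ?; split.
Qed.

Lemma measurable_pos_event : measurable pos_event.
Proof.
rewrite pos_eventE; apply: measurableI.
  by rewrite -[X in measurable X]setTI; exact: measurable_funP.
by rewrite -[X in measurable X]setTI; exact: measurable_funP.
Qed.

Lemma measurable_ratio_moment (k : nat) (a : R -> R) : measurable_fun setT a ->
  measurable_fun setT (fun s : R * R => a (s.2 / s.1) * (s.1 / c1) ^+ k).
Proof.
move=> ma; apply: measurable_funM.
  by apply: (measurableT_comp ma); exact: measurable_fun_div.
by apply: measurable_funX; exact: measurable_funM.
Qed.

Lemma measurable_chi2_moment (k j : nat) (a : R -> R) : measurable_fun setT a ->
  measurable_fun setT (fun v : R * R => a (c2 / c1 * (v.2 / v.1)) * v.1 ^+ k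
    * (v.1 + v.2) ^+ j * chi2_pdf2 v).
Proof.
move=> ma; apply: (@measurable_chi2_ratio R m1 m2 k j (fun z => a (c2 / c1 * z))).
by apply: (measurableT_comp ma); exact: mulrl_measurable.
Qed.

(** The powers may have the wrong sign when a coordinate is not positive, but the density vanishes
    there. *)
Lemma chi2_moment_ge0 (k j : nat) (a : R -> R) (v : R * R) : (forall z, 0 <= a z) ->
  0 <= a (c2 / c1 * (v.2 / v.1)) * v.1 ^+ k * (v.1 + v.2) ^+ j * chi2_pdf2 v.
Proof.
move=> a0.
have [v1|v1] := ltP 0 v.1; last by rewrite (chi2_pdf_le0 m1)// mul0r mulr0.
have [v2|v2] := ltP 0 v.2; last by rewrite (chi2_pdf_le0 m2)// !mulr0.
by rewrite !mulr_ge0 ?chi2_pdf_ge0 ?exprn_ge0 ?addr_ge0// ltW.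
Qed.

(** Given the mixing value [t], [S1 / c1] becomes [v.1 / t] while the ratio [S2 / S1] is free of
    [t], so [t ^- k] factors out. *)
Lemma scale_mixture_moment (k : nat) (a : R -> R) :
  Pi.-integrable setT (fun t : R => (t ^- k)%:E) ->
  measurable_fun setT a -> (forall z, 0 <= a z) ->
  (\int[P]_(x in pos_event) (a (S2 x / S1 x) * (S1 x / c1) ^+ k)%:E =
   (inv_moment Pi k)%:E * \int[leb2]_v
     (a (c2 / c1 * (v.2 / v.1)) * v.1 ^+ k * chi2_pdf2 v)%:E)%E.
Proof.
move=> ik ma a0.
pose f (s : R * R) : R := if (0 < s.1) && (0 < s.2) then
  a (s.2 / s.1) * (s.1 / c1) ^+ k else 0.
have mf : measurable_fun setT f.
  apply: measurable_fun_ifT => //.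
    by apply: measurable_and; exact: measurable_fun_ltr.
  exact: measurable_ratio_moment.
have f0 s : 0 <= f s.
  rewrite /f; case: ifPn => // /andP[s1 _].
  by rewrite mulr_ge0// exprn_ge0// divr_ge0// ltW.
rewrite integral_mkcond.
transitivity (\int[P]_x (f (S1 x, S2 x))%:E)%E.
  apply: eq_integral => x _; rewrite patchE /f/=; case: ifPn.
    by rewrite inE => -[-> ->].
  rewrite notin_setE => /not_andP D; case: ifPn => // /andP[? ?].
  by case: D.
rewrite (scale_mixture_integral Pi P S1 S2 c1 c2 m1 m2)//.
have ge0 v : 0 <= a (c2 / c1 * (v.2 / v.1)) * v.1 ^+ k * chi2_pdf2 v.
  by have := chi2_moment_ge0 k 0 a v a0; rewrite expr0 mulr1.
have mJ : measurable_fun setT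
    (fun v : R * R => a (c2 / c1 * (v.2 / v.1)) * v.1 ^+ k * chi2_pdf2 v).
  by have := measurable_chi2_moment k 0 a ma; under eq_fun do rewrite expr0 mulr1.
set J := (\int[leb2]_v _)%E.
rewrite -integral_pos_inv_moment// -ge0_integralZr//; last 3 first.
- by apply/measurable_funTS/measurable_EFinP; exact: measurable_exprVn.
- move=> t /=; rewrite in_itv/= andbT => t0.
  by rewrite lee_fin invr_ge0 exprn_ge0// ltW.
- by apply: integral_ge0 => v _; rewrite lee_fin.
apply: eq_integral => t; rewrite inE/= in_itv/= andbT => t0.
have [c1t c2t] : 0 < c1 / t /\ 0 < c2 / t by rewrite !divr_gt0.
rewrite -ge0_integralZl_EFin//.
- apply: eq_integral => v _; rewrite /f/= (pmulr_rgt0 _ c1t) (pmulr_rgt0 _ c2t).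
  rewrite -EFinM; congr EFin.
  have [v1|v1] := ltP 0 v.1; last by rewrite (chi2_pdf_le0 m1)// !mul0r !mulr0.
  have [v2|v2] := ltP 0 v.2; last by rewrite (chi2_pdf_le0 m2)// !mulr0.
  rewrite [c2 / t * v.2 / _](_ : _ = c2 / c1 * (v.2 / v.1)); last first.
    by field; rewrite !gt_eqF.
  rewrite [c1 / t * v.1 / _](_ : _ = t^-1 * v.1); last first.
    by field; rewrite !gt_eqF.
  by rewrite exprMn exprVn /= [a _ * _]mulrCA !mulrA.
- by move=> v _; rewrite lee_fin.
- exact/measurable_EFinP.
- by rewrite invr_ge0 exprn_ge0// ltW.
Qed.

Hypotheses (m1_gt0 : (0 < m1)%N) (m2_gt0 : (0 < m2)%N) (c12 : c1 <= c2).

(** Integrating the constant 1 over the whole space and over [pos_event] gives the same double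
    integral, and the first value is 1. The densities are thus normalised by the existence of the
    model. *)
Lemma scale_mixture_mass :
  (\int[@leb2 R]_v (chi2_pdf2 v)%:E = 1 :> \bar R /\ P pos_event = 1)%E.
Proof.
have := @scale_mixture_moment 0 (cst 1) (integrable_inv_moment0 Pi)
  (measurable_cst _) (fun=> ler01).
rewrite inv_moment0 mul1e.
under eq_integral do rewrite /= expr0 mulr1.
rewrite integral_cst; last exact: measurable_pos_event.
rewrite mul1e => ->.
under [X in _ /\ X = _]eq_integral do rewrite /= expr0 !mul1r.
suff -> : (\int[@leb2 R]_v (chi2_pdf2 v)%:E = 1 :> \bar R)%E by [].
have := scale_mixture_integral Pi P S1 S2 c1 c2 m1 m2 (cst 1) rect
  (measurable_cst _) (fun=> ler01).
under [RHS]eq_integral do under eq_integral do rewrite /= mul1r.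
move: (\int[leb2]_v _)%E => J.
rewrite (_ : (fun _ : T => _) = cst 1%E)// (_ : (fun=> J) = cst J)//.
rewrite !integral_cst// [X in (_ * X)%E = _ -> _]probability_setT.
rewrite [X in _ = (_ * X)%E -> _]Pi_pos.
by rewrite !mule1 => <-.
Qed.

(** If one constant were zero, the product density would vanish identically and could not have mass
    1. Positivity is what makes the later comparison strict. *)
Lemma chi2_cst_gt0 : 0 < @chi2_cst R m1 /\ 0 < @chi2_cst R m2.
Proof.
have [I1 _] := scale_mixture_mass.
have I0 : ~ (forall v : R * R, chi2_pdf2 v = 0).
  move=> H; move: I1; under eq_integral do rewrite H.
  by rewrite integral0 => /eqP; rewrite eqe eq_sym oner_eq0.
suff H (m : nat) : @chi2_cst R m = 0 -> forall x : R, chi2_pdf m x = 0.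
  split; rewrite lt_neqAle chi2_cst_ge0 andbT eq_sym; apply/eqP => /H h;
    by apply: I0 => v; rewrite h ?mul0r ?mulr0.
move=> h x; have [x0|x0] := ltP 0 x; last by rewrite chi2_pdf_le0.
by rewrite chi2_pdfE// h mulr0.
Qed.

(* Euler's identity turns the extra factor [v.1 + v.2] into [m1 + m2 + 2k];
   since [c1 <= c2], the ratio [S2 / S1] is at least [v.2 / v.1]. *)
Lemma lt_scale_mixture_moment (k : nat) (a b : R -> R) (del : R) :
  Pi.-integrable setT (fun t : R => (t ^- k)%:E) ->
  Pi.-integrable setT (fun t : R => (t ^- k.+1)%:E) ->
  measurable_fun setT a -> (forall z, 0 <= a z) ->
  measurable_fun setT b -> (forall z, 0 <= b z) ->
  (forall z, 0 < z -> inv_moment Pi k * b z * (1 + z) <=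
     (m1 + m2 + k.*2)%:R * inv_moment Pi k.+1 * a z) ->
  0 < del ->
  (forall z, 0 < z < del -> inv_moment Pi k * b z * (1 + z) <
     (m1 + m2 + k.*2)%:R * inv_moment Pi k.+1 * a z) ->
  (\int[P]_(x in pos_event) (b (S2 x / S1 x) * (S1 x / c1) ^+ k)%:E < +oo)%E ->
  (\int[P]_(x in pos_event) (b (S2 x / S1 x) * (S1 x / c1) ^+ k)%:E <
   \int[P]_(x in pos_event) (a (S2 x / S1 x) * (S1 x / c1) ^+ k.+1)%:E)%E.
Proof.
move=> ik ik1 ma a0 mb b0 ba del0 ba_lt; rewrite !scale_mixture_moment//.
set M : R := (m1 + m2 + k.*2)%:R in ba ba_lt *.
have M0 : 0 < M by rewrite ltr0n !addn_gt0 m1_gt0.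
have ek := inv_moment_gt0 Pi Pi_pos k ik.
have ek1 := inv_moment_gt0 Pi Pi_pos k.+1 ik1.
set rho := c2 / c1.
have rho1 : 1 <= rho by rewrite ler_pdivlMr// mul1r.
have rho0 : 0 < rho by exact: lt_le_trans rho1.
(* By Euler's identity, the factor [v.1 + v.2] divided by [M] leaves the integral of the [b] term
   unchanged. *)
pose F (v : R * R) := inv_moment Pi k / M *
  (b (rho * (v.2 / v.1)) * v.1 ^+ k * (v.1 + v.2) ^+ 1 * chi2_pdf2 v).
pose G (v : R * R) := inv_moment Pi k.+1 *
  (a (rho * (v.2 / v.1)) * v.1 ^+ k.+1 * (v.1 + v.2) ^+ 0 * chi2_pdf2 v).
have mF : measurable_fun setT F.
  by apply: measurable_funM => //; exact: measurable_chi2_moment.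
have mG : measurable_fun setT G.
  by apply: measurable_funM => //; exact: measurable_chi2_moment.
have F0 v : 0 <= F v.
  by apply: mulr_ge0; [rewrite divr_ge0// ltW|exact: chi2_moment_ge0].
have euler : (\int[leb2]_v (F v)%:E = (inv_moment Pi k)%:E * \int[leb2]_v
     (b (rho * (v.2 / v.1)) * v.1 ^+ k * chi2_pdf2 v)%:E)%E.
  have mbr : measurable_fun setT (fun z => b (rho * z)).
    by apply: (measurableT_comp mb); exact: mulrl_measurable.
  have mH j := measurable_chi2_moment k j b mb.
  have H0 j v := chi2_moment_ge0 k j b v b0.
  under eq_integral do rewrite /F EFinM.
  rewrite ge0_integralZl_EFin; last 4 first.
  - by [].
  - by move=> v _; rewrite lee_fin H0.
  - by apply/measurable_EFinP; exact: mH.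
  - by rewrite divr_ge0// ltW.
  have euler := @chi2_euler R m1 m2 k (fun z => b (rho * z)) m1_gt0 m2_gt0 mbr
    (fun=> b0 _).
  transitivity ((inv_moment Pi k / M)%:E * (M%:E * \int[leb2]_v
     (b (rho * (v.2 / v.1)) * v.1 ^+ k * chi2_pdf2 v)%:E))%E; last first.
    by rewrite muleA -EFinM divfK ?gt_eqF.
  congr (_ * _)%E.
  have mH0 : measurable_fun setT
      (fun v : R * R => (b (rho * (v.2 / v.1)) * v.1 ^+ k * chi2_pdf2 v)%:E).
    apply/measurable_EFinP; have := mH 0%N.
    by under eq_fun do rewrite expr0 mulr1.
  have H00 (v : R * R) : (0 <= (b (rho * (v.2 / v.1)) * v.1 ^+ k * chi2_pdf2 v)%:E)%E.
    by have := H0 0%N v; rewrite expr0 mulr1 lee_fin.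
  rewrite -ge0_integralZl_EFin ?ltW//.
  rewrite !leb2_tonelli; last 4 first.
  - exact: emeasurable_funM.
  - by move=> v; rewrite mule_ge0// lee_fin ltW.
  - by apply/measurable_EFinP; exact: mH.
  - by move=> v; rewrite lee_fin H0.
  under eq_integral do under eq_integral do rewrite /= expr1.
  rewrite euler; apply: eq_integral => x _; apply: eq_integral => y _.
  by rewrite -EFinM -!mulrA.
rewrite -euler => Foo.
have -> : ((inv_moment Pi k.+1)%:E * \int[leb2]_v
     (a (rho * (v.2 / v.1)) * v.1 ^+ k.+1 * chi2_pdf2 v)%:E =
     \int[leb2]_v (G v)%:E)%E.
  rewrite -ge0_integralZl_EFin ?ltW//.
  - by apply: eq_integral => v _; rewrite -EFinM /G expr0 mulr1.
  - move=> v _; have := chi2_moment_ge0 k.+1 0 a v a0.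
    by rewrite expr0 mulr1 lee_fin.
  - apply/measurable_EFinP; have := measurable_chi2_moment k.+1 0 a ma.
    by under eq_fun do rewrite expr0 mulr1.
have [k1 k2] := chi2_cst_gt0.
(* Since [v.1 + v.2] is [v.1 * (1 + v.2 / v.1)], [F] and [G] share one nonnegative weight, and only
   their coefficients at [rho * (v.2 / v.1)] remain to be compared. *)
have FE v : 0 < v.1 -> F v = inv_moment Pi k * b (rho * (v.2 / v.1)) *
    (1 + v.2 / v.1) * (v.1 ^+ k.+1 * chi2_pdf2 v / M).
  by move=> v1; rewrite /F expr1 exprS; field; rewrite -!natrD !gt_eqF.
have GE v : G v = M * inv_moment Pi k.+1 * a (rho * (v.2 / v.1)) *
    (v.1 ^+ k.+1 * chi2_pdf2 v / M).
  by rewrite /G expr0; field; rewrite -!natrD gt_eqF.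
have w0 v : 0 < v.1 -> 0 <= v.1 ^+ k.+1 * chi2_pdf2 v / M.
  by move=> v1; rewrite !mulr_ge0 ?chi2_pdf_ge0 ?exprn_ge0 ?invr_ge0// ltW.
(* Enlarging [1 + z] to [1 + rho * z] puts all terms at the same point, where the hypothesis on [a]
   and [b] applies. *)
have le_b z : 0 < z -> inv_moment Pi k * b (rho * z) * (1 + z) <=
    inv_moment Pi k * b (rho * z) * (1 + rho * z).
  move=> z0; apply: ler_wpM2l; first by rewrite mulr_ge0// ltW.
  by rewrite lerD2l ler_peMl// ltW.
(* On this box [v.1 > 1], so [v.2 / v.1 < del / rho] and the strict hypothesis applies; the box has
   positive area. *)
apply: (@lt_ge0_integral _ _ R leb2 (`]1, 2[ `*` `]0, (del / rho)[)) => //.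
- exact: measurableX.
- rewrite [ltRHS]product_measure1E//= !lebesgue_measure_itv/= !lte_fin.
  by rewrite ltr1n divr_gt0//= mule_gt0// -EFinB lte_fin subr_gt0 ?ltr1n ?divr_gt0.
- move=> v; rewrite F0/=.
  have [v1|v1] := ltP 0 v.1; last first.
    by rewrite /F /G (chi2_pdf_le0 m1)// mul0r !mulr0.
  have [v2|v2] := ltP 0 v.2; last first.
    by rewrite /F /G (chi2_pdf_le0 m2)// !mulr0.
  rewrite FE// GE ler_wpM2r ?w0//.
  apply: le_trans (le_b _ _) (ba _ _); first exact: divr_gt0.
  by rewrite mulr_gt0// divr_gt0.
- move=> v [] /=; rewrite !in_itv/= => /andP[v1 v1'] /andP[v2 v2'].
  have v10 : 0 < v.1 by exact: lt_trans v1.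
  rewrite FE// GE ltr_pM2r; last first.
    by rewrite divr_gt0// mulr_gt0 ?exprn_gt0// mulr_gt0 ?chi2_pdf_gt0.
  apply: le_lt_trans (le_b _ _) (ba_lt _ _); first exact: divr_gt0.
  rewrite mulr_gt0 ?divr_gt0//=.
  rewrite mulrC -ltr_pdivlMr//; apply: le_lt_trans v2'.
  by rewrite ler_pdivrMr// ler_peMr// ltW.
Qed.

End scale_mixture_comparison.

(** Combines the balance of losses with the moment comparison. The constant [K] serves finiteness:
    the [b] term is at most [L0 + K], whose expectation is finite because [L0] has finite risk. *)
Lemma lt_scale_mixture_risk {R : realType} {d : measure_display}
    {T : measurableType d} (Pi : probability R R) (P : probability T R)
    (S1 S2 : {mfun T >-> R}) (c1 c2 : R) (m1 m2 k : nat) (L0 L1 : R * R -> R)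
    (a b : R -> R) (del K : R) :
  Pi `]0, +oo[%classic = 1%E -> 0 < c1 -> c1 <= c2 -> (0 < m1)%N -> (0 < m2)%N ->
  scale_mixture_rectangles Pi P S1 S2 c1 c2 m1 m2 ->
  Pi.-integrable setT (fun t : R => (t ^- k)%:E) ->
  Pi.-integrable setT (fun t : R => (t ^- k.+1)%:E) ->
  measurable_fun setT L0 -> measurable_fun setT L1 ->
  measurable_fun setT a -> (forall z, 0 <= a z) ->
  measurable_fun setT b -> (forall z, 0 <= b z) ->
  (forall s : R * R, 0 < s.1 -> 0 < s.2 ->
    [/\ 0 <= L0 s, 0 <= L1 s,
        b (s.2 / s.1) * (s.1 / c1) ^+ k <= L0 s + K &
        L1 s + a (s.2 / s.1) * (s.1 / c1) ^+ k.+1 =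
        L0 s + b (s.2 / s.1) * (s.1 / c1) ^+ k]) ->
  0 <= K ->
  (forall z, 0 < z -> inv_moment Pi k * b z * (1 + z) <=
     (m1 + m2 + k.*2)%:R * inv_moment Pi k.+1 * a z) ->
  0 < del ->
  (forall z, 0 < z < del -> inv_moment Pi k * b z * (1 + z) <
     (m1 + m2 + k.*2)%:R * inv_moment Pi k.+1 * a z) ->
  (\int[P]_x (L0 (S1 x, S2 x))%:E < +oo)%E ->
  (\int[P]_x (L1 (S1 x, S2 x))%:E < \int[P]_x (L0 (S1 x, S2 x))%:E)%E.
Proof.
move=> Pi_pos c10 c12 m10 m20 rect ik ik1 mL0 mL1 ma a0 mb b0 bal K0 ba del0 ba_lt L0oo.
have c20 : 0 < c2 by exact: lt_le_trans c12.
have mS : measurable_fun setT (fun x => (S1 x, S2 x)) by exact: measurable_fun_pair.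
have mD := measurable_pos_event S1 S2.
have [_ PD] := scale_mixture_mass Pi P S1 S2 Pi_pos c1 c2 m1 m2 c10 c20 rect.
have mA := measurableT_comp (measurable_ratio_moment c1 k.+1 a ma) mS.
have mB := measurableT_comp (measurable_ratio_moment c1 k b mb) mS.
have mL0S := measurableT_comp mL0 mS.
have mL1S := measurableT_comp mL1 mS.
have Boo : (\int[P]_(x in pos_event S1 S2)
    (b (S2 x / S1 x) * (S1 x / c1) ^+ k)%:E < +oo)%E.
  apply: (@le_lt_trans _ _ (\int[P]_(x in pos_event S1 S2)
     ((L0 (S1 x, S2 x))%:E + K%:E))%E).
    apply: ge0_le_integral => //.
    - move=> x [s1 s2]; rewrite lee_fin mulr_ge0// exprn_ge0// divr_ge0//; exact: ltW.
    - exact/measurable_funTS/measurable_EFinP.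
    - by apply/measurable_funTS/emeasurable_funD => //; exact/measurable_EFinP.
    - by move=> x [s1 s2]; have [_ _ le_b _] := bal (S1 x, S2 x) s1 s2.
  rewrite ge0_integralD//.
  - rewrite (_ : (fun=> K%:E) = cst K%:E)// integral_cst// [X in (_ + _ * X)%E]PD.
    rewrite mule1 lte_add_pinfty ?ltry//.
    by rewrite -integral_full_event//; exact/measurable_EFinP.
  - by move=> x [s1 s2]; have [l0 _ _ _] := bal (S1 x, S2 x) s1 s2.
  - exact/measurable_funTS/measurable_EFinP.
apply: (@lt_expectation_balance _ _ _ P (pos_event S1 S2) _ _
  (fun x => a (S2 x / S1 x) * (S1 x / c1) ^+ k.+1)
  (fun x => b (S2 x / S1 x) * (S1 x / c1) ^+ k)) => //.
- move=> x [s1 s2]; have [l0 l1 _ _] := bal (S1 x, S2 x) s1 s2.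
  by split => //; rewrite mulr_ge0// exprn_ge0// divr_ge0// ltW.
- by move=> x [s1 s2]; have [] := bal (S1 x, S2 x) s1 s2.
- exact: (@lt_scale_mixture_moment _ _ _ Pi P S1 S2 Pi_pos c1 c2 m1 m2 _ _ _ _ _ _
    k a b del).
Qed.

(** With unconstrained boxes every normal factor has mass one. *)
Lemma scale_mixture_model_rectangles (R : realType) (p q m1 m2 : nat)
    (Pi : probability R R) (d : measure_display) (T : measurableType d)
    (P : probability T R) (tau : {mfun T >-> R})
    (X1 : {mfun T >-> p.-tuple R}) (S1 : {mfun T >-> R})
    (X2 : {mfun T >-> q.-tuple R}) (S2 : {mfun T >-> R}) (th : param R p q) :
  scale_mixture_model m1 m2 Pi P tau X1 S1 X2 S2 th ->
  scale_mixture_rectangles Pi P S1 S2 (sigma1 th ^+ 2) (sigma2 th ^+ 2) m1 m2.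
Proof.
move=> [_ joint] C1 C2 mC1 mC2.
have := joint setT (fun=> setT) C1 (fun=> setT) C2 measurableT
  (fun=> measurableT) mC1 (fun=> measurableT) mC2.
have boxT n : @box R n (fun=> setT) = setT by apply/seteqP; split.
rewrite !boxT !preimage_setT !setTI setIT => ->.
apply: eq_integral => t _.
have nT n (mn : n.-tuple R) v : normal_box mn v (fun=> setT) = 1%E.
  by apply: big1 => i _; exact: probability_setT.
by rewrite !nT mul1e mule1.
Qed.

(** * The multipliers of [S1] in the two estimators *)

Section truncated_multiplier.
Context {R : realType}.
Variables (n1 n2 kap : R).
Hypotheses (n1_gt0 : 0 < n1) (n2_gt0 : 0 < n2) (kap_gt0 : 0 < kap).

(* With [kap = E(tau^-1) / E(tau^-2)], [n1 = m1 + 2] for the squared error loss and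
   [kap = 1 / E(tau^-1)], [n1 = m1] for the entropy loss, [full_mult * S1] is the
   best equivariant estimator and [trunc_mult (S2 / S1) * S1] its improvement. *)
Definition full_mult : R := kap / n1.

Definition trunc_mult (z : R) : R :=
  if 0 <= z <= n2 / n1 then (1 + z) * kap / (n1 + n2) else full_mult.

Let n12 : 0 < n1 + n2. Proof. exact: addr_gt0. Qed.

Lemma measurable_trunc_mult : measurable_fun setT trunc_mult.
Proof.
apply: measurable_fun_ifT => //.
  by apply: measurable_and; exact: measurable_fun_ler.
by apply: measurable_funM => //; apply: measurable_funM => //; exact: measurable_funD.
Qed.

Lemma full_mult_gt0 : 0 < full_mult. Proof. exact: divr_gt0. Qed.

Lemma trunc_mult_gt0 z : 0 < trunc_mult z.
Proof.
rewrite /trunc_mult; case: ifPn => [/andP[z0 _]|_]; last exact: full_mult_gt0.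
by rewrite divr_gt0// mulr_gt0// ltr_pwDl.
Qed.

(** The threshold [n2 / n1] is where the two branches coincide, and the first branch increases in
    [z]. *)
Lemma trunc_mult_le z : trunc_mult z <= full_mult.
Proof.
rewrite /trunc_mult; case: ifPn => // /andP[_].
rewrite ler_pdivlMr// -subr_ge0 => z1; have h := mulr_ge0 (ltW kap_gt0) z1.
by rewrite /full_mult ler_pdivrMr// [leRHS]mulrAC ler_pdivlMr//; lra.
Qed.

Lemma trunc_mult_lt z : 0 < z < n2 / n1 -> trunc_mult z < full_mult.
Proof.
move=> /andP[z0 z1]; rewrite /trunc_mult (ltW z0) (ltW z1)/=.
move: z1; rewrite ltr_pdivlMr// -subr_gt0 => z1; have h := mulr_gt0 kap_gt0 z1.
by rewrite /full_mult ltr_pdivrMr// [ltRHS]mulrAC ltr_pdivlMr//; lra.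
Qed.

(** Splits the pointwise inequalities: either the multipliers agree and both sides vanish, or the
    linear relation eliminates [1 + z]. *)
Lemma trunc_multE z : trunc_mult z = full_mult \/
  (n1 + n2) * trunc_mult z = (1 + z) * kap.
Proof.
rewrite /trunc_mult; case: ifPn => _; [right|by left].
by rewrite mulrC divfK// gt_eqF.
Qed.

(** On the first branch the ratio is the bound divided by [1 + z], with [z >= 0]. This bounds the
    logarithmic term of the entropy loss uniformly. *)
Lemma full_mult_ratio_le z : full_mult / trunc_mult z <= (n1 + n2) / n1.
Proof.
rewrite ler_pdivrMr ?trunc_mult_gt0// /trunc_mult; case: ifPn => [/andP[z0 _]|_].
  rewrite /full_mult.
  have -> : (n1 + n2) / n1 * ((1 + z) * kap / (n1 + n2)) = kap / n1 + z * (kap / n1).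
    by field; rewrite !gt_eqF.
  by rewrite lerDl mulr_ge0// divr_ge0// ltW.
by rewrite ler_peMl ?(ltW full_mult_gt0)// ler_pdivlMr// mul1r lerDl ltW.
Qed.

End truncated_multiplier.

Lemma ln_lt_sub1 {R : realType} (x : R) : 0 < x -> x != 1 -> ln x < x - 1.
Proof.
move=> x0 x1; rewrite -ltr_expR lnK ?posrE//.
by have := @expR_gt1Dx R (x - 1); rewrite subr_eq0 addrC subrK; exact.
Qed.

Lemma ln_le_sub1 {R : realType} (x : R) : 0 < x -> ln x <= x - 1.
Proof.
move=> x0; have [->|x1] := eqVneq x 1; first by rewrite ln1 subrr.
exact/ltW/ln_lt_sub1.
Qed.

(** * Strict risk inequalities for the two losses *)

Section risks.
Context {R : realType} {d : measure_display} {T : measurableType d}.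
Variables (Pi : probability R R) (P : probability T R) (S1 S2 : {mfun T >-> R}).
Hypothesis Pi_pos : Pi `]0, +oo[%classic = 1%E.
Variables (c1 c2 : R) (m1 m2 : nat).
Hypotheses (c1_gt0 : 0 < c1) (c12 : c1 <= c2).
Hypotheses (m1_gt0 : (0 < m1)%N) (m2_gt0 : (0 < m2)%N).
Hypothesis rect : scale_mixture_rectangles Pi P S1 S2 c1 c2 m1 m2.
Hypothesis int1 : Pi.-integrable setT (fun t : R => (t ^- 1)%:E).

Let m2R : 0 < m2%:R :> R. Proof. by rewrite ltr0n. Qed.

Let e1_gt0 : 0 < inv_moment Pi 1. Proof. exact: inv_moment_gt0. Qed.

Lemma sq_risk_lt : Pi.-integrable setT (fun t : R => (t ^- 2)%:E) ->
  (\int[P]_x (sq_loss (delta01Q Pi m1 (S1 x)) c1)%:E < +oo)%E ->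
  (\int[P]_x (sq_loss (delta11Q Pi m1 m2 (S1 x) (S2 x)) c1)%:E <
   \int[P]_x (sq_loss (delta01Q Pi m1 (S1 x)) c1)%:E)%E.
Proof.
move=> int2.
have e2_gt0 : 0 < inv_moment Pi 2 by exact: inv_moment_gt0.
have [n1 n1E] : exists n1 : R, n1 = (m1 + 2)%:R by exists (m1 + 2)%:R.
have n1_gt0 : 0 < n1 by rewrite n1E ltr0n addn2.
have NE : (m1 + m2 + 2)%:R = n1 + m2%:R by rewrite n1E -natrD addnAC.
pose kap := inv_moment Pi 1 / inv_moment Pi 2.
have kap_gt0 : 0 < kap by exact: divr_gt0.
pose phi0 := full_mult n1 kap.
pose phi := trunc_mult n1 m2%:R kap.
have mphi : measurable_fun setT phi by exact: measurable_trunc_mult.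
have phi_gt0 z : 0 < phi z by exact: trunc_mult_gt0.
have phi_le z : phi z <= phi0 by exact: trunc_mult_le.
have d0E s : delta01Q Pi m1 s = phi0 * s.
  by rewrite /delta01Q /phi0 /full_mult /kap -n1E; congr (_ * _); field; rewrite !gt_eqF.
have d1E s1 s2 : delta11Q Pi m1 m2 s1 s2 = phi (s2 / s1) * s1.
  rewrite /delta11Q /phi /trunc_mult -n1E/=; move: (s2 / s1) => z; case: ifPn => _; last first.
    by rewrite -/phi0 -d0E /delta01Q n1E.
  rewrite NE /kap; congr (_ * _); field.
  by rewrite !gt_eqF ?addr_gt0.
under eq_integral do rewrite d0E.
under [X in (_ -> X < _)%E]eq_integral do rewrite d1E.
have kapE z : phi z = phi0 \/
    (m1 + m2 + 2)%:R * inv_moment Pi 2 * phi z = (1 + z) * inv_moment Pi 1.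
  have := @trunc_multE _ n1 m2%:R kap n1_gt0 m2R z.
  rewrite -/phi -/(phi z) -/phi0 => -[->|h]; first by left.
  right; rewrite NE mulrAC h /kap; field; by rewrite gt_eqF.
have phi_lt z : 0 < z < m2%:R / n1 -> phi z < phi0 by exact: trunc_mult_lt.
(* Replacing [(1 + z) * inv_moment Pi 1] by means of the linear relation turns the gap into a
   multiple of a square, positive as soon as [phi z < phi0]. *)
have diffE z :
    (m1 + m2 + 2)%:R * inv_moment Pi 2 * phi z = (1 + z) * inv_moment Pi 1 ->
    (m1 + m2 + 2)%:R * inv_moment Pi 2 * (phi0 ^+ 2 - phi z ^+ 2)
    - inv_moment Pi 1 * (2 * (phi0 - phi z)) * (1 + z) =
    (m1 + m2 + 2)%:R * inv_moment Pi 2 * (phi0 - phi z) ^+ 2.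
  move=> h; rewrite [X in _ - X = _](_ : _ = 2 * (phi0 - phi z) *
    ((1 + z) * inv_moment Pi 1)); last by ring.
  by rewrite -h; ring.
clearbody phi0 phi.
apply: (@lt_scale_mixture_risk _ _ _ Pi P S1 S2 c1 c2 m1 m2 1
  (fun s => sq_loss (phi0 * s.1) c1) (fun s => sq_loss (phi (s.2 / s.1) * s.1) c1)
  (fun z => phi0 ^+ 2 - phi z ^+ 2) (fun z => 2 * (phi0 - phi z))
  (m2%:R / n1) 3) => //.
- rewrite /sq_loss; apply: measurable_funX; apply: measurable_funB => //.
  by apply: measurable_funM => //; exact: measurable_funM.
- rewrite /sq_loss; apply: measurable_funX; apply: measurable_funB => //.
  apply: measurable_funM => //; apply: measurable_funM => //.
  by apply: (measurableT_comp mphi); exact: measurable_fun_div.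
- by apply: measurable_funB => //; exact: measurable_funX.
- by move=> z; rewrite subr_ge0 lerXn2r ?nnegrE// ltW// (lt_le_trans (phi_gt0 z)).
- by apply: measurable_funM => //; exact: measurable_funB.
- by move=> z; rewrite mulr_ge0// subr_ge0.
- move=> [s1 s2] /= s10 s20; rewrite /sq_loss !sqr_ge0 -!mulrA.
  have := phi_le (s2 / s1).
  have := phi_gt0 (s2 / s1).
  move: (phi (s2 / s1)) => f f0 f1.
  have t0 : 0 < s1 / c1 by exact: divr_gt0.
  move: (s1 / c1) t0 => t t0.
  split => //; last by ring.
  (* The constant 3 completes a square: with [x = phi0 * t], the bound follows from
     [2 * x <= (x - 1) ^+ 2 + 3], that is [0 <= (x - 2) ^+ 2]. *)
  rewrite expr1; have h1 : 0 < f * t by exact: mulr_gt0.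
  have := sqr_ge0 (phi0 * t - 2); nra.
- move=> z z0; have [->|h] := kapE z; first by rewrite !subrr !mulr0 mul0r.
  by rewrite -subr_ge0 -[1.*2]/2%N diffE// mulr_ge0 ?sqr_ge0// mulr_ge0// ltW.
- exact: divr_gt0.
- move=> z zlt; have flt := phi_lt z zlt.
  have [h|h] := kapE z; first by rewrite h ltxx in flt.
  have N0 : 0 < (m1 + m2 + 2)%:R :> R by rewrite ltr0n addn2.
  by rewrite -subr_gt0 -[1.*2]/2%N diffE// mulr_gt0 ?exprn_gt0 ?subr_gt0// mulr_gt0.
Qed.

Lemma entropy_risk_lt :
  (\int[P]_x (entropy_loss (delta01E Pi m1 (S1 x)) c1)%:E < +oo)%E ->
  (\int[P]_x (entropy_loss (delta11E Pi m1 m2 (S1 x) (S2 x)) c1)%:E <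
   \int[P]_x (entropy_loss (delta01E Pi m1 (S1 x)) c1)%:E)%E.
Proof.
have [n1 n1E] : exists n1 : R, n1 = m1%:R by exists m1%:R.
have n1_gt0 : 0 < n1 by rewrite n1E ltr0n.
pose kap := (inv_moment Pi 1)^-1.
have kap_gt0 : 0 < kap by rewrite invr_gt0.
pose phi0 := full_mult n1 kap.
pose phi := trunc_mult n1 m2%:R kap.
have mphi : measurable_fun setT phi by exact: measurable_trunc_mult.
have phi0_gt0 : 0 < phi0 by exact: full_mult_gt0.
have phi_gt0 z : 0 < phi z by exact: trunc_mult_gt0.
have phi_le z : phi z <= phi0 by exact: trunc_mult_le.
have d0E s : delta01E Pi m1 s = phi0 * s.
  rewrite /delta01E /phi0 /full_mult /kap -n1E; field; by rewrite !gt_eqF.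
have d1E s1 s2 : delta11E Pi m1 m2 s1 s2 = phi (s2 / s1) * s1.
  rewrite /delta11E /phi /trunc_mult -n1E/=; move: (s2 / s1) => z; case: ifPn => _; last first.
    by rewrite -/phi0 -d0E /delta01E n1E.
  rewrite natrD -n1E /kap; congr (_ * _); field.
  by rewrite !gt_eqF ?addr_gt0.
under eq_integral do rewrite d0E.
under [X in (_ -> X < _)%E]eq_integral do rewrite d1E.
have ratio_gt0 z : 0 < phi0 / phi z by exact: divr_gt0.
have ratio_ge1 z : 1 <= phi0 / phi z by rewrite ler_pdivlMr// mul1r.
have mln (f : R * R -> R) : measurable_fun setT f ->
    measurable_fun setT (fun s => entropy_loss (f s) c1).
  move=> mf; have mfc : measurable_fun setT (fun s => f s / c1).
    exact: measurable_funM.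
  apply: measurable_funB => //; apply: measurable_funB => //.
  exact: (measurableT_comp (@measurable_ln R)).
have entropy_ge0 (t : R) : 0 < t -> 0 <= entropy_loss t c1.
  move=> t0; rewrite /entropy_loss; have := @ln_le_sub1 R (t / c1) (divr_gt0 t0 c1_gt0).
  by lra.
have kapE z : phi z = phi0 \/ (m1 + m2)%:R * inv_moment Pi 1 * phi z = 1 + z.
  have := @trunc_multE _ n1 m2%:R kap n1_gt0 m2R z.
  rewrite -/phi -/(phi z) -/phi0 => -[->|h]; first by left.
  by right; rewrite natrD -n1E mulrAC h mulfVK ?gt_eqF.
have phi_lt z : 0 < z < m2%:R / n1 -> phi z < phi0 by exact: trunc_mult_lt.
have ratio_le z : phi0 / phi z <= (n1 + m2%:R) / n1 by exact: full_mult_ratio_le.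
(* For [N = (m1 + m2)%:R * inv_moment Pi 1] the linear relation makes [N * phi z] equal to [1 + z],
   so the pointwise inequality becomes [ln x <= x - 1] at [x = phi0 / phi z]. *)
have rhsE z (N : R) : N * (phi0 - phi z) = N * phi z * (phi0 / phi z - 1).
  by field; rewrite gt_eqF.
clearbody phi0 phi.
apply: (@lt_scale_mixture_risk _ _ _ Pi P S1 S2 c1 c2 m1 m2 0
  (fun s => entropy_loss (phi0 * s.1) c1)
  (fun s => entropy_loss (phi (s.2 / s.1) * s.1) c1)
  (fun z => phi0 - phi z) (fun z => ln (phi0 / phi z))
  (m2%:R / n1) ((n1 + m2%:R) / n1)) => //.
- exact: integrable_inv_moment0.
- by apply: mln; exact: measurable_funM.
- apply: mln; apply: measurable_funM => //.
  by apply: (measurableT_comp mphi); exact: measurable_fun_div.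
- exact: measurable_funB.
- by move=> z; rewrite subr_ge0.
- by apply: (measurableT_comp (@measurable_ln R)); exact: measurable_fun_div.
- by move=> z; exact: ln_ge0.
- move=> [s1 s2] /= s10 s20; split.
  + by apply: entropy_ge0; exact: mulr_gt0.
  + by apply: entropy_ge0; exact: mulr_gt0.
  + rewrite expr0 mulr1.
    (* The logarithm is at most the ratio minus 1, hence at most the constant chosen for [K], and
       the loss is nonnegative. *)
    have le1 := @ln_le_sub1 R _ (ratio_gt0 (s2 / s1)).
    have le2 := ratio_le (s2 / s1).
    have := entropy_ge0 (phi0 * s1) (mulr_gt0 phi0_gt0 s10).
    by lra.
  + have t0 : 0 < s1 / c1 by exact: divr_gt0.
    rewrite /entropy_loss -!mulrA expr0 expr1 mulr1 ln_div ?posrE//.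
    by move: (s1 / c1) t0 => t t0; rewrite !lnM ?posrE//; ring.
- by rewrite divr_ge0 ?addr_ge0// ltW.
- move=> z z0; rewrite inv_moment0 double0 addn0 mul1r.
  have [->|h] := kapE z; first by rewrite divff ?gt_eqF// ln1 mul0r subrr mulr0.
  rewrite rhsE -h [leRHS]mulrC ler_wpM2r ?ln_le_sub1//.
  by rewrite h addr_ge0// ltW.
- exact: divr_gt0.
- move=> z zlt; rewrite inv_moment0 double0 addn0 mul1r; have flt := phi_lt z zlt.
  have [h|h] := kapE z; first by rewrite h ltxx in flt.
  rewrite rhsE -h [ltRHS]mulrC ltr_pM2r; last first.
    by rewrite h addr_gt0//; case/andP: zlt.
  by apply: ln_lt_sub1 => //; rewrite gt_eqF// ltr_pdivlMr// mul1r.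
Qed.

End risks.

Theorem corollary2p3 (R : realType) (p q m1 m2 : nat)
    (hp : (0 < p)%N) (hq : (0 < q)%N) (hm1 : (0 < m1)%N) (hm2 : (0 < m2)%N)
    (Pi : probability R R) (hPi : Pi (`]0, +oo[%classic) = 1%E)
    (hE1 : Pi.-integrable setT (fun t : R => (t ^- 1)%:E))
    (d : measure_display) (T : measurableType d)
    (P : param R p q -> probability T R)
    (tau : {mfun T >-> R})
    (X1 : {mfun T >-> p.-tuple R}) (S1 : {mfun T >-> R})
    (X2 : {mfun T >-> q.-tuple R}) (S2 : {mfun T >-> R})
    (hmodel : forall th : param R p q, admissible th ->
      scale_mixture_model m1 m2 Pi (P th) tau X1 S1 X2 S2 th) :
  (Pi.-integrable setT (fun t : R => (t ^- 2)%:E) ->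
   finite_risk P sq_loss (fun w => delta01Q Pi m1 (S1 w)) ->
   dominates P sq_loss (fun w => delta11Q Pi m1 m2 (S1 w) (S2 w))
                       (fun w => delta01Q Pi m1 (S1 w))) /\
  (finite_risk P entropy_loss (fun w => delta01E Pi m1 (S1 w)) ->
   uniformly_smaller_risk P entropy_loss
     (fun w => delta11E Pi m1 m2 (S1 w) (S2 w))
     (fun w => delta01E Pi m1 (S1 w))).
Proof.
have rect th (ath : admissible th) :=
  scale_mixture_model_rectangles _ _ _ _ _ _ _ _ _ _ _ _ _ _ _ (hmodel th ath).
have sig (th : param R p q) : admissible th ->
    0 < sigma1 th ^+ 2 /\ sigma1 th ^+ 2 <= sigma2 th ^+ 2.
  move=> [s10 [s20 s12]]; split; first exact: exprn_gt0.
  by rewrite lerXn2r// nnegrE ltW.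
split=> [hE2 fin|fin th ath]; last first.
  have [c0 c12] := sig th ath; have := fin th ath.
  by rewrite /risk unlock => ?; exact: (entropy_risk_lt _ _ _ _ hPi _ _ _ _ c0 c12 _ _ (rect th ath)).
have lt th : admissible th -> (risk P sq_loss
    (fun w => delta11Q Pi m1 m2 (S1 w) (S2 w)) th <
    risk P sq_loss (fun w => delta01Q Pi m1 (S1 w)) th)%E.
  move=> ath; have [c0 c12] := sig th ath; have := fin th ath.
  by rewrite /risk unlock => ?; exact: (sq_risk_lt _ _ _ _ hPi _ _ _ _ c0 c12 _ _ (rect th ath)).
split=> [th /lt/ltW//|].
(* The inequality is strict at every admissible parameter, so any one serves as witness: here zero
   means and equal unit scales. *)
pose th0 := Param [tuple of nseq p 0] [tuple of nseq q 0] (1 : R) 1.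
by exists th0; split; [|apply: lt].
Qed.
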